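(* For $m$-almost every $\omega\in\Omega$ there exists a subset $Q_\omega\subset Q$ of full Lebesgue measure such that for all $z\in Q_\omega$ the set of accumulation points of the sequence $(F_\omega^n(z))_{n=0}^\infty$ is contained in $[0,+\infty]\cup\{-\infty\}$ and contains $+\infty$.
   Context: Setting. $(\Omega,\mathcal F,m)$ is a complete probability space; $\theta:\Omega\to\Omega$ is an invertible measurable map with measurable inverse, preserving $m$ and ergodic with respect to $m$. Real constants $B>A>1/e$ are fixed, and $\eta:\Omega\to[A,B]$ is measurable. For $\omega\in\Omega$ put $f_\omega(z)=\eta(\omega)e^z$, $f_\omega:\mathbb C\to\mathbb C$. Let $Q=\mathbb C/2\pi i\mathbb Z$ be the cylinder with quotient map $\pi:\mathbb C\to Q$. Since $f_\omega$ is $2\pi i$-periodic, $\pi\circ f_\omega$ descends to a holomorphic map $F_\omega:Q\to Q$. Put $F_\omega^n:=F_{\theta^{n-1}\omega}\circ\cdots\circ F_{\theta\omega}\circ F_\omega$ ($F^0_\omega=\mathrm{id}$). Accumulation points are taken in the two-ended compactification $Q\cup\{-\infty,+\infty\}$ of the cylinder, where a sequence in $Q$ converges to $\pm\infty$ if its real part tends to $\pm\infty$. The real line is identified with its image $\pi(\mathbb R)\subset Q$, so $[0,+\infty]$ means $\pi([0,+\infty))\cup\{+\infty\}$. *)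

(* Defs.v *)
From HB Require Import structures.
From mathcomp Require Import all_boot all_order all_algebra.
From mathcomp Require Import complex.
From mathcomp Require Import all_classical all_reals all_analysis.
Import Order.TTheory GRing.Theory Num.Theory.
Import numFieldNormedType.Exports.

Set Implicit Arguments.
Unset Strict Implicit.
Unset Printing Implicit Defensive.

Local Open Scope classical_set_scope.
Local Open Scope ring_scope.
Local Open Scope complex_scope.
Local Open Scope quotient_scope.

(* The norm topology of the complex field. *)
HB.instance Definition _ (R : realType) :=
  PseudoPointedMetric.copy R[i] (R[i])^o.

Section cylinder.
Context {R : realType}.

Definition two_pi_i_Z : {pred R[i]} :=
  [pred z : R[i] | `[< exists k : int, z = 0 +i* (2 * pi * k%:~R) >]].

Lemma two_pi_i_Z_closed : zmod_closed two_pi_i_Z.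
Proof.
split=> [|x y]; first by apply/asboolP; exists 0; rewrite mulr0.
move=> /asboolP[k ->] /asboolP[l ->]; apply/asboolP; exists (k - l).
by rewrite intrB mulrBr; apply/eqP; rewrite eq_complex /= subr0 !eqxx.
Qed.

HB.instance Definition _ :=
  GRing.isZmodClosed.Build R[i] two_pi_i_Z two_pi_i_Z_closed.

End cylinder.

Definition cylinder (R : realType) : Type :=
  quotient_topology (Quotient.quot (@two_pi_i_Z R)).

HB.instance Definition _ (R : realType) := Topological.on (cylinder R).
HB.instance Definition _ (R : realType) := Pointed.on (cylinder R).
HB.instance Definition _ (R : realType) := Quotient.on (cylinder R).

Section maps.
Context {R : realType}.
Local Notation Q := (cylinder R).
Local Notation Re := (@complex.Re R).
Local Notation Im := (@complex.Im R).

Definition cyl_pi : R[i] -> Q := \pi_Q.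

Definition cexp (z : R[i]) : R[i] :=
  (expR (Re z) * cos (Im z)) +i* (expR (Re z) * sin (Im z)).

Definition f_exp (a : R) (z : R[i]) : R[i] := a%:C * cexp z.

(* The values on representatives chosen by [repr]; [F_exp_pi] and [cyl_Re_pi]
   state the independence of that choice. *)
Definition F_exp (a : R) (q : Q) : Q := cyl_pi (f_exp a (repr q)).

Definition cyl_Re (q : Q) : R := Re (repr q).

Lemma cyl_piP (x y : R[i]) :
  cyl_pi x = cyl_pi y <-> exists k : int, x - y = 0 +i* (2 * pi * k%:~R).
Proof.
have -> : (cyl_pi x = cyl_pi y) <-> x - y \in two_pi_i_Z.
  have E : (x - y \in two_pi_i_Z) = (cyl_pi x == cyl_pi y).
    by rewrite (Quotient.idealrBE two_pi_i_Z x y); apply/eqP/eqP.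
  by rewrite E; split=> /eqP.
by split=> /asboolP.
Qed.

Lemma cyl_Re_pi (z : R[i]) : cyl_Re (cyl_pi z) = Re z.
Proof.
have /cyl_piP[k] : cyl_pi (repr (cyl_pi z)) = cyl_pi z by exact: reprK.
rewrite /cyl_Re; case: (repr _) => a b; case: z => c d [/= + _].
by move/eqP; rewrite subr_eq0 => /eqP.
Qed.

Lemma periodicz (T : zmodType) (f : R -> T) (p : R) (k : int) x :
  (forall y, f (y + p) = f y) -> f (x + p * k%:~R) = f x.
Proof.
move=> fp; have fpn n y : f (y + p * n%:R) = f y.
  by elim: n y => [|n IH] y; rewrite ?mulr0 ?addr0// -natr1 mulrDr mulr1 addrA fp.
case: k => n; first exact: fpn.
by rewrite NegzE mulrNz mulrN -(fpn n.+1 (_ - _)) subrK.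
Qed.

Lemma F_exp_pi (a : R) (z : R[i]) : F_exp a (cyl_pi z) = cyl_pi (f_exp a z).
Proof.
have /cyl_piP[k] : cyl_pi (repr (cyl_pi z)) = cyl_pi z by exact: reprK.
rewrite /F_exp; case: (repr _) => u v; case: z => c d [/= /eqP + /eqP].
rewrite subr_eq0 => /eqP -> ; rewrite subr_eq addrC => /eqP ->.
congr (cyl_pi (_ * (_ * _ +i* (_ * _)))).
- by apply: periodicz => y; rewrite mulrC mulr_natr cosD2pi.
- by apply: periodicz => y; rewrite mulrC mulr_natr sinD2pi.
Qed.

End maps.

(* [rand_iter theta eta n w] is F_{theta^(n-1) w} \o ... \o F_w. *)
Fixpoint rand_iter {R : realType} {Omega : Type} (theta : Omega -> Omega)
    (eta : Omega -> R) (n : nat) (w : Omega) (q : cylinder R) : cylinder R :=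
  if n is k.+1 then F_exp (eta (iter k theta w)) (rand_iter theta eta k w q)
  else q.

Section lebesgue.
Context {R : realType}.
Local Notation Q := (cylinder R).

Definition plane_to_cyl (p : R * R) : Q := cyl_pi (p.1 +i* p.2).

(* The quotient sigma-algebra, which is the Borel sigma-algebra of [Q]. *)
Definition cyl_measurable : set (set Q) :=
  [set U | measurable (plane_to_cyl @^-1` U)].

Lemma cyl_measurable0 : cyl_measurable set0.
Proof. by rewrite /cyl_measurable/= preimage_set0. Qed.

Lemma cyl_measurableC U : cyl_measurable U -> cyl_measurable (~` U).
Proof. by rewrite /cyl_measurable/= preimage_setC; exact: measurableC. Qed.

Lemma cyl_measurable_bigcup (F : (set Q)^nat) :
  (forall i, cyl_measurable (F i)) -> cyl_measurable (\bigcup_i F i).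
Proof.
move=> mF; rewrite /cyl_measurable/= preimage_bigcup.
by apply: bigcup_measurable => i _; exact: mF.
Qed.

End lebesgue.

Fact cyl_display : measure_display. Proof. exact: default_measure_display. Qed.

HB.instance Definition _ (R : realType) :=
  isMeasurable.Build cyl_display (cylinder R)
    cyl_measurable0 cyl_measurableC cyl_measurable_bigcup.

Section lebesgue_cylinder.
Context {R : realType}.

Lemma measurable_plane_to_cyl :
  measurable_fun setT (@plane_to_cyl R).
Proof. by move=> _ U mU; rewrite setTI. Qed.

(* A fundamental domain of the projection: { x + iy | -pi < y <= pi }. *)
Definition strip : set (R * R) := setT `*` `]- pi, pi].

Lemma measurable_strip : measurable strip.
Proof. exact: measurableX. Qed.

Definition cyl_lebesgue : set (cylinder R) -> \bar R :=
  pushforward (mrestr (lebesgue_measure \x lebesgue_measure)%E measurable_strip)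
    plane_to_cyl.

Let cyl_lebesgue0 : cyl_lebesgue set0 = 0%E.
Proof. by have mf := measurable_plane_to_cyl; exact: measure0. Qed.

Let cyl_lebesgue_ge0 U : (0 <= cyl_lebesgue U)%E.
Proof. by have mf := measurable_plane_to_cyl; exact: measure_ge0. Qed.

Let cyl_lebesgue_sigma_additive : semi_sigma_additive cyl_lebesgue.
Proof. by have mf := measurable_plane_to_cyl; exact: measure_semi_sigma_additive. Qed.

HB.instance Definition _ := isMeasure.Build _ _ _ cyl_lebesgue
  cyl_lebesgue0 cyl_lebesgue_ge0 cyl_lebesgue_sigma_additive.

End lebesgue_cylinder.

Inductive ecylinder (R : realType) : Type :=
  CylFin of cylinder R | CylMinf | CylPinf.
Arguments CylMinf {R}.
Arguments CylPinf {R}.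

HB.instance Definition _ (R : realType) := gen_eqMixin (ecylinder R).
HB.instance Definition _ (R : realType) := gen_choiceMixin (ecylinder R).

Section two_ended_compactification.
Context {R : realType}.
Local Notation Qbar := (ecylinder R).

Definition ecyl_open : set_system Qbar := [set U |
  [/\ open (@CylFin R @^-1` U),
      U CylMinf -> exists M : R, forall q, cyl_Re q < M -> U (CylFin q) &
      U CylPinf -> exists M : R, forall q, M < cyl_Re q -> U (CylFin q)]].

Lemma ecyl_openT : ecyl_open setT.
Proof. by split; [exact: openT|exists 0|exists 0]. Qed.

Lemma ecyl_openI : setI_closed ecyl_open.
Proof.
move=> U V [oU Um Up] [oV Vm Vp]; split; first exact: openI.
- move=> [/Um[M UM] /Vm[N VN]]; exists (Num.min M N) => q.
  by rewrite lt_min => /andP[/UM ? /VN].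
- move=> [/Up[M UM] /Vp[N VN]]; exists (Num.max M N) => q.
  by rewrite gt_max => /andP[/UM ? /VN].
Qed.

Lemma ecyl_open_bigU (I : Type) (f : I -> set Qbar) :
  (forall i, ecyl_open (f i)) -> ecyl_open (\bigcup_i f i).
Proof.
move=> of_; split.
- by rewrite preimage_bigcup; apply: bigcup_open => i _; have [] := of_ i.
- move=> [i _ fi]; have [_ /(_ fi)[M fM] _] := of_ i.
  by exists M => q /fM; exists i.
- move=> [i _ fi]; have [_ _ /(_ fi)[M fM]] := of_ i.
  by exists M => q /fM; exists i.
Qed.

HB.instance Definition _ :=
  isOpenTopological.Build Qbar ecyl_openT ecyl_openI ecyl_open_bigU.

Lemma ecyl_openE : @open Qbar = ecyl_open.
Proof. by []. Qed.

Lemma normc_Re_le (z : R[i]) : (`|complex.Re z|)%:C <= `|z|.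
Proof.
rewrite normc_def lecR -sqrtr_sqr ler_sqrt; last by rewrite addr_ge0 ?sqr_ge0.
by rewrite lerDl sqr_ge0.
Qed.

Lemma cyl_Re_continuous : continuous (@cyl_Re R).
Proof.
apply/quotient_continuous.
have -> : @cyl_Re R \o \pi_(cylinder R) = @complex.Re R.
  by apply/funext => z; exact: cyl_Re_pi.
move=> z U /nbhs_ballP[e /= e0 eU].
apply/nbhs_ballP; exists e%:C; first by rewrite /= ltcR.
move=> w zw; apply: eU; rewrite /ball/=.
rewrite -ltcR; apply: le_lt_trans zw.
by rewrite -[X in `|X|](_ : complex.Re (z - w) = _) ?normc_Re_le//; case: (z) (w) => ? ? [].
Qed.

(* A sequence of the cylinder converges to an end iff its real part does. *)
Lemma cvg_CylPinf (u : (cylinder R)^nat) :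
  (fun n => CylFin (u n)) @ \oo --> (CylPinf : Qbar) <->
  (fun n => cyl_Re (u n)) @ \oo --> +oo.
Proof.
split=> [cu|cu].
  apply/cvgryPgt => M.
  have : nbhs (CylPinf : Qbar)
     [set p | if p is CylFin q then M < cyl_Re q else p = CylPinf].
    apply: open_nbhs_nbhs; split=> //; rewrite ecyl_openE; split=> //=.
    - by apply: open_comp (@open_gt _ M) => q _; exact: cyl_Re_continuous.
    - by exists M.
  by move/cu.
move=> U; rewrite nbhsE => -[V [+ Vp] VU]; rewrite ecyl_openE => -[_ _ /(_ Vp)[M VM]].
have /cvgryPgt /(_ M) := cu.
by apply: filterS => n /VM /VU.
Qed.

Lemma cvg_CylMinf (u : (cylinder R)^nat) :
  (fun n => CylFin (u n)) @ \oo --> (CylMinf : Qbar) <->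
  (fun n => cyl_Re (u n)) @ \oo --> -oo.
Proof.
split=> [cu|cu].
  apply/cvgrNyPlt => M.
  have : nbhs (CylMinf : Qbar)
     [set p | if p is CylFin q then cyl_Re q < M else p = CylMinf].
    apply: open_nbhs_nbhs; split=> //; rewrite ecyl_openE; split=> //=.
    - by apply: open_comp (@open_lt _ M) => q _; exact: cyl_Re_continuous.
    - by exists M.
  by move/cu.
move=> U; rewrite nbhsE => -[V [+ Vm] VU]; rewrite ecyl_openE => -[_ /(_ Vm)[M VM] _].
have /cvgrNyPlt /(_ M) := cu.
by apply: filterS => n /VM /VU.
Qed.

Definition accumulation_points (u : (cylinder R)^nat) : set Qbar :=
  cluster ((fun n => CylFin (u n)) @ \oo).

End two_ended_compactification.

(* [0, +oo], the nonnegative reals being identified with their image in Q. *)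
Definition nonneg_axis {R : realType} : set (ecylinder R) :=
  [set CylFin (cyl_pi x%:C) | x in [set x : R | 0 <= x]] `|` [set CylPinf].

Definition measure_preserving d (T : measurableType d) (R : realType)
    (m : {measure set T -> \bar R}) (theta : T -> T) : Prop :=
  measurable_fun setT theta /\
  forall E, measurable E -> m (theta @^-1` E) = m E.

Definition ergodic d (T : measurableType d) (R : realType)
    (m : probability T R) (theta : T -> T) : Prop :=
  forall E, measurable E -> theta @^-1` E = E -> m E = 0%E \/ m E = 1%E.

(* Main.v *)
(* Lift the dynamics to the plane, f_a(x + iy) = a e^x (cos y + i sin y), and
   consider the infinite measure M = dx dy / y^2.  Since
   sum_k 1 / (y + 2 pi k)^2 = 1 / (4 sin^2 (y / 2)), the image of M under f_a
   has density 1 / (2 r (r - x)) with r^2 = x^2 + y^2, whatever a > 0 is, and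
     1 / y^2 - 1 / (2 r (r - x)) = 1 / (2 r (r + x)) > 0.
   So M decreases under every f_a by at least the fixed positive density
   1 / (2 r (r + x)).  By invariance of m the same holds for the skew product
   on Omega x C with m x M, where the lost masses can be summed along orbits: if
   the lift of K has finite image mass, then almost every orbit visits K only
   finitely often.  This applies to sets K exhausting the complement of
   [0, +oo[ in the cylinder, which yields the first claim.  If moreover the real
   parts were eventually bounded above, the orbit would eventually stay so close
   to [0, +oo[ that each step increases the real part by a fixed amount, because
   A e^x >= x + 1 + ln A > x; hence +oo is an accumulation point. *)
Require Import Defs.
From HB Require Import structures.
From mathcomp Require Import all_boot all_order all_algebra.
From mathcomp Require Import complex.
From mathcomp Require Import ring lra.
From mathcomp Require Import all_classical all_reals all_analysis.
From mathcomp Require Import measurable_realfun.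
Import Order.TTheory GRing.Theory Num.Theory.
Import numFieldNormedType.Exports.

Set Implicit Arguments.
Unset Strict Implicit.
Unset Printing Implicit Defensive.

Local Open Scope classical_set_scope.
Local Open Scope ring_scope.

(** * Change of variables on the line *)

Section transfer.
Local Open Scope ereal_scope.
Context d1 d2 (X : measurableType d1) (Y : measurableType d2) (R : realType).
Variables (mu1 : {measure set X -> \bar R}) (mu2 : {measure set Y -> \bar R}).
Variables (I : set X) (S : X -> Y) (D : Y -> R).
Hypotheses (mI : measurable I) (mS : measurable_fun setT S).
Hypotheses (mD : measurable_fun setT D) (D0 : forall y, (0 <= D y)%R).
Hypothesis ISD : forall E, measurable E ->
  mu1 (I `&` S @^-1` E) = \int[mu2]_(y in E) (D y)%:E.

Import HBNNSimple.

(** By [ISD] the image under [S] of [mu1] restricted to [I] has density [D]. Linearity takes this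
    from indicators to simple functions, and monotone convergence along [nnsfun_approx] to every
    nonnegative [h]. *)
Lemma ge0_integral_transfer (h : Y -> \bar R) : measurable_fun setT h ->
  (forall y, 0 <= h y) ->
  \int[mu1]_(x in I) h (S x) = \int[mu2]_y (h y * (D y)%:E).
Proof.
move=> mh h0; pose g := nnsfun_approx measurableT mh.
have gE y : limn (fun n => (g n y)%:E) = h y.
  by apply/cvg_lim => //; exact: cvg_nnsfun_approx.
have gnd n m y : (n <= m)%N -> (g n y <= g m y)%R.
  by move=> nm; exact/lefP/nd_nnsfun_approx.
have mDE : measurable_fun setT (EFin \o D) by exact/measurable_EFinP.
have mSI (f : Y -> \bar R) : measurable_fun setT f ->
    measurable_fun I (f \o S).
  by move=> mf; apply: measurable_funTS; exact: measurableT_comp.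
transitivity (limn (fun n => \int[mu1]_(x in I) (g n (S x))%:E)).
  rewrite -monotone_convergence//.
  - by apply: eq_integral => x _; rewrite gE.
  - move=> n; apply: (mSI (EFin \o g n)).
    exact/measurable_EFinP/measurable_funP.
  - by move=> n x _; rewrite lee_fin.
  - by move=> x _ n m nm; rewrite lee_fin gnd.
transitivity (limn (fun n => \int[mu2]_y ((g n y)%:E * (D y)%:E))); last first.
  rewrite -monotone_convergence//.
  - apply: eq_integral => y _; rewrite -gE.
    under eq_fun do rewrite muleC.
    rewrite limeMl//; last first.
      by apply/cvg_ex; exists (h y); exact: cvg_nnsfun_approx.
    by rewrite muleC.
  - move=> n; apply: emeasurable_funM => //.
    exact/measurable_EFinP/measurable_funP.
  - by move=> n x _; rewrite mule_ge0// lee_fin.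
  - by move=> x _ n m nm; rewrite lee_wpmul2r// ?lee_fin// gnd.
apply/congr_lim/funext => n.
transitivity (\sum_(k \in range (g n))
    \int[mu1]_(x in I) (k * \1_(g n @^-1` [set k]) (S x))%:E).
  under eq_integral do rewrite fimfunE -fsumEFin//.
  rewrite ge0_integral_fsum//.
  - move=> k; apply: (mSI (fun y => (k * \1_(g n @^-1` [set k]) y)%:E)).
    exact/measurable_EFinP/measurable_funM.
  - by move=> k x _; exact: nnfun_muleindic_ge0.
transitivity (\sum_(k \in range (g n))
    \int[mu2]_y ((k * \1_(g n @^-1` [set k]) y)%:E * (D y)%:E)); last first.
  rewrite -ge0_integral_fsum//.
  - apply: eq_integral => y _; rewrite [in RHS]fimfunE -fsumEFin//.
    rewrite ge0_mule_fsuml// => k.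
    exact: nnfun_muleindic_ge0.
  - move=> k; apply: emeasurable_funM => //.
    exact/measurable_EFinP/measurable_funM.
  - move=> k y _; apply: mule_ge0; last by rewrite lee_fin.
    exact: nnfun_muleindic_ge0.
apply: eq_fsbigr => k; rewrite inE => -[y0 _ gky].
have k0 : (0 <= k)%R by rewrite -gky.
under eq_integral do rewrite EFinM.
under [RHS]eq_integral do rewrite EFinM -muleA.
have mk : measurable (g n @^-1` [set k]) by exact: measurable_sfunP.
rewrite ge0_integralZl_EFin//; last first.
  apply: (mSI (fun y => (\1_(g n @^-1` [set k]) y)%:E)).
  exact/measurable_EFinP/measurable_indic.
rewrite [RHS]ge0_integralZl_EFin//; last first.
- by apply: emeasurable_funM => //; exact/measurable_EFinP/measurable_indic.
- by move=> x _; rewrite mule_ge0 ?lee_fin.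
congr (_ * _).
transitivity (mu1 (I `&` S @^-1` (g n @^-1` [set k]))).
  rewrite setIC -integral_indic//.
  by rewrite -[X in measurable X]setTI; exact: mS.
rewrite ISD// [LHS]integral_mkcond; apply: eq_integral => y _.
rewrite patchE indicE; case: ifPn => _; rewrite ?mul1e ?mul0e//.
Qed.

End transfer.

Section density.
Local Open Scope ereal_scope.
Context d (X : measurableType d) (R : realType).
Variable mu : {measure set X -> \bar R}.
Variable D : X -> R.
Hypotheses (mD : measurable_fun setT D) (D0 : forall x, (0 <= D x)%R).

(** The two properties of [D] are arguments so that the measure structure declared below can be
    inferred from the term itself. *)
Definition density of measurable_fun setT D & (forall x, (0 <= D x)%R) :=
  fun E : set X => \int[mu]_(x in E) (D x)%:E.

Local Notation nu := (density mD D0).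

Let nu0 : nu set0 = 0. Proof. exact: integral_set0. Qed.

Let nu_ge0 E : 0 <= nu E.
Proof. by apply: integral_ge0 => x _; rewrite lee_fin. Qed.

Let nu_sigma_additive : semi_sigma_additive nu.
Proof.
move=> F mF tF mUF; rewrite /density ge0_integral_bigcup//.
- by apply: is_cvg_ereal_nneg_natsum => n _; exact: nu_ge0.
- by apply/measurable_EFinP; exact: measurable_funTS.
- by move=> x _; rewrite lee_fin.
Qed.

HB.instance Definition _ := isMeasure.Build _ _ _ nu
  nu0 nu_ge0 nu_sigma_additive.

End density.

Lemma pushforward_restr_measure d1 d2 (X : measurableType d1)
    (Y : measurableType d2) (R : realType) (mu : {measure set X -> \bar R})
    (I : set X) (f : X -> Y) (mI : measurable I) (mf : measurable_fun setT f) :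
  exists nu : {measure set Y -> \bar R},
    forall A, nu A = mu (I `&` f @^-1` A).
Proof.
pose nu := [the {measure set Y -> \bar R} of pushforward (mrestr mu mI) f].
by exists (nu mf) => A; rewrite setIC.
Qed.

Section substitution.
Local Open Scope ereal_scope.
Context (R : realType).
Local Notation mu := (@lebesgue_measure R).
Variables (I : set R) (S T D : R -> R).
Hypotheses (iI : is_interval I) (mI : measurable I).
Hypothesis mS : measurable_fun setT S.
Hypotheses (D0 : forall x, (0 <= D x)%R) (cD : continuous D).
Hypothesis IT : forall x, I (T x).
Hypothesis SK : forall y, I y -> T (S y) = y.

Let mD : measurable_fun setT D.
Proof. exact: continuous_measurable_fun. Qed.

(** The image measure and the measure with density [D] give []p, q]] the same mass, the latter by
    the fundamental theorem of calculus. They then agree on all Borel sets, since half-open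
    intervals are stable under intersection. [F] is [T] or [- T], according to monotonicity. *)
Let integral_substitution (F : R -> R) :
  (forall x : R, is_derive x 1%R F (D x)) ->
  (forall p q, (p < q)%R -> mu (I `&` S @^-1` `]p, q]) = (F q - F p)%:E) ->
  forall h : R -> \bar R, measurable_fun setT h -> (forall y, 0 <= h y) ->
  \int[mu]_(y in I) h (S y) = \int[mu]_x (h x * (D x)%:E).
Proof.
move=> dF ISF h mh h0.
have := @ge0_integral_transfer _ _ _ _ R mu mu I S D mI mS mD D0 _ h mh h0.
apply=> E mE.
have [m1 m1E] :=
  @pushforward_restr_measure _ _ _ (measurableTypeR R) R mu I S mI mS.
pose m2 : {measure set (measurableTypeR R) -> \bar R} := density mu mD D0.
transitivity (m1 E); first by rewrite m1E.
rewrite -[RHS]/(m2 E).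
have oc p q : (p < q)%R -> m2 `]p, q]%classic = (F q - F p)%:E.
  move=> pq; rewrite /m2/= /density integral_itv_obnd_cbnd//; last first.
    by apply/measurable_EFinP; exact: measurable_funTS.
  have cF x : {for x, continuous F}.
    apply/differentiable_continuous/derivable1_diffP.
    by have := dF x; case.
  rewrite (@continuous_FTC2 _ _ F)//.
  - exact: continuous_subspaceT.
  - split; first by move=> x _; have := dF x; case.
    + by apply: cvg_at_right_filter; exact: cF.
    + by apply: cvg_at_left_filter; exact: cF.
  - by move=> x _; rewrite derive1E; apply: derive_val.
have m12 A : ocitv A -> m1 A = m2 A.
  move=> [[p q] _ <-]; rewrite m1E /=.
  have [pq|qp] := ltP p q; first by rewrite ISF// oc.
  rewrite set_itv_ge ?bnd_simp -?leNgt//.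
  by rewrite preimage_set0 setI0 !measure0.
(* Uniqueness of measures requires an exhaustion by intervals of finite mass; [g 0] is empty and is
   treated apart because [oc] asks for p < q. *)
pose g n : set (measurableTypeR R) := `](- n%:R)%R, (n%:R)%R]%classic.
have Gg n : ocitv (g n) by exists (- n%:R, n%:R)%R.
have gT : \bigcup_n g n = setT.
  rewrite -subTset => x _; exists (Num.truncn `|x|).+1 => //=.
  have := truncnS_gt `|x|.
  by rewrite ltr_norml /g/= in_itv/= => /andP[-> /ltW ->].
have goo n : m1 (g n) < +oo.
  rewrite m12// /g; have [->|n0] := eqVneq n 0%N.
    by rewrite set_itv_ge ?measure0// bnd_simp oppr0 ltxx.
  by rewrite oc ?ltry// gt0_cp// ltr0n lt0n.
exact: (@measure_unique _ R (measurableTypeR R) (@ocitv R) g erefl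
  (@ocitvI R) Gg gT m1 m2 m12 goo).
Qed.

(** On [I] the map [S] inverts [T], and [I] is an interval containing the values of [T], so the
    points of [I] sent into []p, q]] form []T p, T q]]. Outside [I] the map [S] may be arbitrary. *)
Lemma integral_substitution_incr :
  (forall x : R, is_derive x 1%R T (D x)) -> {homo T : x y / (x < y)%R} ->
  forall h : R -> \bar R, measurable_fun setT h -> (forall y, 0 <= h y) ->
  \int[mu]_(y in I) h (S y) = \int[mu]_x (h x * (D x)%:E).
Proof.
move=> dT Tlt; apply: integral_substitution dT _ => p q pq.
have Tle := le_mono Tlt; have Tmono := leW_mono Tle.
have -> : I `&` S @^-1` `]p, q] = `]T p, T q]%classic.
  apply/seteqP; split => y /=; rewrite !in_itv/=.
    by move=> [Iy]; rewrite -Tmono -Tle SK.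
  move=> /andP[py yq]; have Iy : I y.
    by apply: (iI (IT p) (IT q)); rewrite (ltW py).
  by split => //; rewrite -Tmono -Tle SK// py.
by rewrite lebesgue_measure_itv/= lte_fin Tmono pq.
Qed.

Lemma integral_substitution_decr :
  (forall x : R, is_derive x 1%R T (- D x)%R) ->
  {homo T : x y /~ (x < y)%R} ->
  forall h : R -> \bar R, measurable_fun setT h -> (forall y, 0 <= h y) ->
  \int[mu]_(y in I) h (S y) = \int[mu]_x (h x * (D x)%:E).
Proof.
move=> dT Tlt; apply: (@integral_substitution (\- T)%R) => [x|p q pq].
  by rewrite -[D x]opprK; apply: is_deriveN.
have Tle := le_nmono Tlt; have Tmono := leW_nmono Tle.
have -> : I `&` S @^-1` `]p, q] = `[T q, T p[%classic.
  apply/seteqP; split => y /=; rewrite !in_itv/=.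
    by move=> [Iy]; rewrite -Tmono -Tle SK// andbC.
  move=> /andP[qy yp]; have Iy : I y.
    by apply: (iI (IT q) (IT p)); rewrite qy (ltW yp).
  by split => //; rewrite -Tmono -Tle SK// qy andbT.
by rewrite lebesgue_measure_itv/= lte_fin Tmono pq EFinD opprK addeC.
Qed.

End substitution.

(** * Partial sums of the Eisenstein series of the squared cosecant *)

Section cosecant.
Context {R : realType}.
Implicit Types u v x : R.

Lemma norm_sin_le u : `|sin u| <= `|u|.
Proof.
wlog u0 : u / 0 <= u.
  move=> H; have [/H//|/ltW u0] := leP 0 u.
  by rewrite -normrN -sinN -[leRHS]normrN H// oppr_ge0.
have [c _ E] : exists2 c, c \in `[0, u] & sin u - sin 0 = cos c * (u - 0).
  apply: (@MVT_segment _ sin cos) => //.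
  by apply: continuous_subspaceT; exact: continuous_sin.
move: E; rewrite sin0 !subr0 => ->.
by rewrite normrM ler_piMl// ler_norml cos_geN1 cos_le1.
Qed.

Lemma invr_sqr_le_sin v : 0 < v < pi -> v ^- 2 <= sin v ^- 2.
Proof.
move=> vpi; have /andP[v0 _] := vpi; have sv := sin_gt0_pi vpi.
rewrite lef_pV2 ?posrE ?exprn_gt0// -[sin v]gtr0_norm//.
rewrite -[leRHS]real_normK ?num_real//.
by rewrite ler_pXn2r ?nnegrE// norm_sin_le.
Qed.

(** Write sin v = 2 s c with s = sin (v / 2) and c = cos (v / 2) = sin (pi / 2 - v / 2); then 1 /
    (s^2 c^2) = 1 / s^2 + 1 / c^2. *)
Lemma invr_sin_double v : 0 < v < pi ->
  sin v ^- 2 = 4^-1 * (sin (v / 2) ^- 2 + sin (pi / 2 - v / 2) ^- 2).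
Proof.
move=> /andP[v0 vpi].
have c0 : 0 < cos (v / 2) by rewrite cos_gt0_pihalf//; lra.
have s0 : 0 < sin (v / 2) by rewrite sin_gt0_pihalf//; lra.
rewrite sinB cos_pihalf sin_pihalf mul1r mul0r subr0.
have {1}-> : v = v / 2 *+ 2 by rewrite mulr2n -splitr.
rewrite sin_mulr2n.
have := cos2Dsin2 (v / 2); move: (cos _) (sin _) c0 s0 => c s c0 s0 cs.
have -> : c ^- 2 = s ^- 2 * s ^+ 2 / c ^+ 2.
  by rewrite mulVf ?mul1r// sqrf_eq0 gt_eqF.
have -> : s ^- 2 + s ^- 2 * s ^+ 2 / c ^+ 2 =
    (c ^+ 2 + s ^+ 2) / (c ^+ 2 * s ^+ 2).
  by field; rewrite !gt_eqF.
rewrite cs; field; rewrite !gt_eqF//=.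
Qed.

(** Pairs j with its mirror image 2N - 1 - j: halving the angles in the j-th term of the cosecant
    sum produces exactly these two indices. *)
Lemma big_ord_double (V : nmodType) (N : nat) (c : nat -> V) :
  \sum_(j < N + N) c j = \sum_(j < N) (c j + c (N + N - j.+1)%N).
Proof.
rewrite big_split_ord big_split/=; congr (_ + _).
rewrite (reindex_inj rev_ord_inj); apply: eq_bigr => j _ /=.
by rewrite addnBA.
Qed.

(* The iterated half-angle identity
   [csc^2 v = (csc^2 (v/2) + csc^2 ((pi-v)/2)) / 4]. *)
Lemma invr_sin_sum n v : 0 < v < pi ->
  sin v ^- 2 = (4 ^+ n.+1)^-1 * \sum_(j < 2 ^ n)
    (sin ((v + pi * j%:R) / 2 ^+ n.+1) ^- 2 +
     sin ((pi * j.+1%:R - v) / 2 ^+ n.+1) ^- 2).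
Proof.
move=> /andP[v0 vpi]; elim: n => [|n ->].
  rewrite expn0 big_ord1 /= !expr1 mulr0 addr0 mulr1 mulrBl.
  by rewrite invr_sin_double ?v0.
rewrite expnS mul2n -addnn (big_ord_double _ (fun j =>
  sin ((v + pi * j%:R) / 2 ^+ n.+2) ^- 2 +
  sin ((pi * j.+1%:R - v) / 2 ^+ n.+2) ^- 2)).
rewrite (exprS 4 n.+1) invfM -mulrA [RHS]mulrCA; congr *%R.
rewrite mulr_sumr.
apply: eq_bigr => j _.
have p2 : 0 < 2 ^+ n :> R by rewrite exprn_gt0.
have jn : j.+1%:R <= 2 ^+ n :> R by rewrite -natrX ler_nat.
have j1 : j.+1%:R = j%:R + 1 :> R by rewrite natr1.
have pi0 : 0 < pi :> R := pi_gt0 _.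
have pj : 0 <= pi * j%:R :> R by rewrite mulr_ge0// ltW.
have pjn : pi * (j%:R + 1) <= pi * 2 ^+ n :> R by rewrite -j1 ler_pM2l.
have E2 : 2 ^+ n.+1 = 2 * 2 ^+ n :> R by rewrite exprS.
have E3 : 2 ^+ n.+2 = 4 * 2 ^+ n :> R by rewrite !exprS; ring.
rewrite (invr_sin_double (v := (v + pi * j%:R) / _)); last first.
  by rewrite E2 divr_gt0 ?mulr_gt0// ?ltr_pdivrMr ?mulr_gt0//; lra.
rewrite (invr_sin_double (v := (_ - v) / _)); last first.
  by rewrite E2 j1 divr_gt0 ?mulr_gt0// ?ltr_pdivrMr ?mulr_gt0//; lra.
have k1 : (2 ^ n + 2 ^ n - j.+1)%:R = 2 * 2 ^+ n - j%:R - 1 :> R.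
  rewrite natrB; last by rewrite (leq_trans (ltn_ord j))// leq_addr.
  by rewrite natrD natrX j1; ring.
have k2 : (2 ^ n + 2 ^ n - j.+1).+1%:R = 2 * 2 ^+ n - j%:R :> R.
  by rewrite -natr1 k1; ring.
rewrite k1 k2 -mulrDr E2 E3 j1; congr (_ * _).
have q0 : 2 ^+ n != 0 :> R by rewrite gt_eqF.
have e x : x / (2 * 2 ^+ n) / 2 = x / (4 * 2 ^+ n) by field.
have e1 : pi / 2 - (v + pi * j%:R) / (2 * 2 ^+ n) / 2 =
  (pi * (2 * 2 ^+ n - j%:R) - v) / (4 * 2 ^+ n) by field.
have e2 : pi / 2 - (pi * (j%:R + 1) - v) / (2 * 2 ^+ n) / 2 =
  (v + pi * (2 * 2 ^+ n - j%:R - 1)) / (4 * 2 ^+ n) by field.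
by rewrite e1 e2 !e addrACA; congr (_ + _); rewrite addrC.
Qed.

(** Among the 2^n terms of [invr_sin_sum] keep the first n and apply sin t <= t to each; the powers
    of 2 cancel. This is the one inequality of csc^2 v = sum_k 1 / (v + k pi)^2 that the transfer
    estimate calls for. *)
Lemma invr_sqr_sum_le n v : 0 < v < pi ->
  \sum_(j < n) ((v + pi * j%:R) ^- 2 + (pi * j.+1%:R - v) ^- 2) <= sin v ^- 2.
Proof.
move=> vpi; rewrite (invr_sin_sum n vpi) mulr_sumr.
have /andP[v0 vpi'] := vpi.
have pi0 : 0 < pi :> R := pi_gt0 _.
have p2 : 0 < 2 ^+ n.+1 :> R by rewrite exprn_gt0.
have E4 : 4 ^+ n.+1 = (2 ^+ n.+1) ^+ 2 :> R.
  by rewrite exprAC; congr (_ ^+ _); rewrite -natrX.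
have n2 : (n <= 2 ^ n)%N by rewrite ltnW// ltn_expl.
rewrite (big_ord_widen _ (fun j : nat =>
  (v + pi * j%:R) ^- 2 + (pi * j.+1%:R - v) ^- 2) n2).
rewrite big_mkcond/=; apply: ler_sum => j _.
have pj : 0 <= pi * j%:R :> R by rewrite mulr_ge0// ltW.
have jn : j.+1%:R <= 2 ^+ n :> R by rewrite -natrX ler_nat.
have j1 : j.+1%:R = j%:R + 1 :> R by rewrite natr1.
have pjn : pi * (j%:R + 1) <= pi * 2 ^+ n :> R by rewrite -j1 ler_pM2l.
have le x : 0 < x < pi * 2 ^+ n.+1 ->
    x ^- 2 <= (4 ^+ n.+1)^-1 * sin (x / 2 ^+ n.+1) ^- 2.
  move=> /andP[x0 xp].
  have := @invr_sqr_le_sin (x / 2 ^+ n.+1).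
  rewrite divr_gt0//= ltr_pdivrMr// => /(_ xp) H.
  rewrite E4; move: p2 H; set c := 2 ^+ n.+1 => c0 H.
  have -> : x ^- 2 = (c ^+ 2)^-1 * (x / c) ^- 2 by field; rewrite !gt_eqF.
  by rewrite ler_pM2l// invr_gt0 exprn_gt0.
case: ifPn => _; last first.
  by rewrite mulr_ge0 ?addr_ge0 ?invr_ge0 ?sqr_ge0 ?exprn_ge0.
by rewrite mulrDr lerD// le// exprS ?j1; lra.
Qed.

End cosecant.

(** * The transfer inequality for the measure dx dy / y^2 *)

Section half_plane.
Context {R : realType}.
Local Notation mu := (@lebesgue_measure R).

Lemma measurable_invr : measurable_fun [set: R] (@GRing.inv R).
Proof.
have m0 : measurable [set~ (0 : R)] by exact: measurableC.
rewrite -(setvU [set (0 : R)]); apply/measurable_funU => //; split.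
  apply: open_continuous_measurable_fun.
    by rewrite openC; exact: closed_eq.
  by move=> x; rewrite inE => /eqP x0; exact: inv_continuous.
exact: measurable_fun_set1.
Qed.

Lemma measurable_sin : measurable_fun [set: R] sin.
Proof. apply: continuous_measurable_fun; exact: continuous_sin. Qed.

Lemma measurable_cos : measurable_fun [set: R] cos.
Proof. apply: continuous_measurable_fun; exact: continuous_cos. Qed.

Lemma measurable_atan : measurable_fun [set: R] atan.
Proof. apply: continuous_measurable_fun; exact: continuous_atan. Qed.

Local Open Scope ereal_scope.

Lemma integral_exp_subst (k : R) (h : R -> \bar R) : (0 < k)%R ->
  measurable_fun setT h -> (forall y, 0 <= h y) ->
  \int[mu]_x h (k * expR x)%R = \int[mu]_(y in `]0%R, +oo[) (h y * (y^-1)%:E).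
Proof.
move=> k0 mh h0; have k0' : (k != 0)%R by rewrite gt_eqF.
have mk : measurable_fun setT (fun x : R => (k * expR x)%R).
  by apply: measurable_funM => //; exact: measurable_expR.
have pos x : (0 < k * expR x)%R by rewrite mulr_gt0 ?expR_gt0.
(* The factor 1 / y is put into the integrand so that it cancels the derivative k e^x of the
   substitution y = k e^x. *)
pose h' x := h (k * expR x)%R * ((k * expR x)^-1)%:E.
have mh' : measurable_fun setT h'.
  apply: emeasurable_funM; first exact: measurableT_comp.
  apply/measurable_EFinP; apply: measurableT_comp mk.
  exact: measurable_invr.
have h'0 x : 0 <= h' x by rewrite mule_ge0// lee_fin invr_ge0 ltW.
have mS : measurable_fun setT (fun y : R => ln (y / k)).
  apply: (@measurableT_comp _ _ _ _ _ _ (@ln R)); first exact: measurable_ln.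
  exact: mulrr_measurable.
have cT : continuous (fun x : R => (k * expR x)%R).
  by move=> x; apply: cvgM; [exact: cvg_cst|exact: continuous_expR].
have TI x : `]0%R, +oo[%classic (k * expR x)%R.
  by rewrite /= in_itv/= andbT.
have SK y : `]0%R, +oo[%classic y -> (k * expR (ln (y / k)))%R = y.
  rewrite /= in_itv/= andbT => y0.
  by rewrite lnK ?posrE ?divr_gt0// mulrC divfK.
have dT (x : R) : is_derive x 1%R (fun x => k * expR x)%R (k * expR x)%R.
  exact: is_derive_eq.
have incrT : {homo (fun x => k * expR x)%R : x y / (x < y)%R}.
  by move=> x y xy; rewrite ltr_pM2l// ltr_expR.
transitivity (\int[mu]_x (h' x * (k * expR x)%:E)).
  apply: eq_integral => x _; rewrite /h' -muleA -EFinM mulVf ?mule1//.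
  by rewrite gt_eqF.
rewrite -(integral_substitution_incr (@interval_is_interval _ _)
  (measurable_itv _) mS (fun x => ltW (pos x)) cT TI SK dT incrT mh' h'0).
apply: eq_integral => y; rewrite inE => y0.
by rewrite /h' SK.
Qed.

(* The polar angle of [(x, b)], for [b > 0], in ]2k pi, (2k+1) pi[. *)
Definition arccot_branch (b : R) (k : int) (x : R) : R :=
  (2 * pi * k%:~R + (pi / 2 - atan (x / b)))%R.

Lemma sin_shift (k : int) (x : R) : sin (2 * pi * k%:~R + x) = sin x.
Proof.
by rewrite addrC; apply: periodicz => y; rewrite mulrC mulr_natr sinD2pi.
Qed.

Lemma cos_shift (k : int) (x : R) : cos (2 * pi * k%:~R + x) = cos x.
Proof.
by rewrite addrC; apply: periodicz => y; rewrite mulrC mulr_natr cosD2pi.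
Qed.

Lemma arccot_branchK (b : R) (k : int) (y : R) : (0 < b)%R ->
  y \in `](2 * pi * k%:~R)%R, (2 * pi * k%:~R + pi)%R[ ->
  arccot_branch b k (b * (cos y / sin y)) = y.
Proof.
move=> b0; have b0' : (b != 0)%R by rewrite gt_eqF.
rewrite in_itv/= => yI.
have [t yt] : exists t, y = (2 * pi * k%:~R + t)%R.
  by exists (y - 2 * pi * k%:~R)%R; ring.
move: yI; rewrite {}yt ltrDl ltrD2l => /andP[t0 tpi].
rewrite cos_shift sin_shift /arccot_branch.
rewrite [X in atan X](_ : _ = tan (pi / 2 - t)).
  by rewrite tanK; [ring|rewrite in_itv/=; lra].
rewrite /tan sinB cosB cos_pihalf sin_pihalf !mul0r !mul1r.
by rewrite subr0 add0r mulrAC divff// mul1r.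
Qed.

(** On the k-th interval the inverse of y |-> b cot y is [arccot_branch b k], which decreases with
    derivative - b / (x^2 + b^2); the density is thus the same for all k. *)
Lemma integral_cot_subst (b : R) (k : int) (h : R -> \bar R) : (0 < b)%R ->
  measurable_fun setT h -> (forall y, 0 <= h y) ->
  \int[mu]_(y in `](2 * pi * k%:~R)%R, (2 * pi * k%:~R + pi)%R[%classic)
    h (b * (cos y / sin y))%R =
  \int[mu]_x (h x * (b / (x ^+ 2 + b ^+ 2))%:E).
Proof.
move=> b0 mh h0; set c : R := (2 * pi * k%:~R)%R.
have b0' : (b != 0)%R by rewrite gt_eqF.
have mS : measurable_fun setT (fun y : R => b * (cos y / sin y))%R.
  apply: measurable_funM => //; apply: measurable_funM.
    exact: measurable_cos.
  by apply: measurableT_comp; [exact: measurable_invr|exact: measurable_sin].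
have D0 x : (0 <= b / (x ^+ 2 + b ^+ 2))%R.
  by rewrite divr_ge0 ?addr_ge0 ?sqr_ge0 ?ltW.
have xb0 x : (0 < x ^+ 2 + b ^+ 2)%R by rewrite ltr_wpDl ?sqr_ge0 ?exprn_gt0.
have cD : continuous (fun x : R => b / (x ^+ 2 + b ^+ 2))%R.
  move=> x; apply: cvgM; first exact: cvg_cst.
  apply: cvgV; first by rewrite gt_eqF.
  by apply: cvgD; [apply: cvgM; exact: cvg_id|exact: cvg_cst].
have TI x : `]c, (c + pi)%R[%classic (arccot_branch b k x).
  rewrite /= in_itv/= /arccot_branch -/c; have := atan_gtNpi2 (x / b).
  by have := atan_ltpi2 (x / b); lra.
have SK := arccot_branchK (k := k) b0.
have dT (x : R) : is_derive x 1%R (arccot_branch b k)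
    (- (b / (x ^+ 2 + b ^+ 2)))%R.
  rewrite /arccot_branch; apply: is_derive_eq.
  rewrite scaler0 !add0r !mul1r [in LHS]/GRing.scale/= mulr1.
  by field; rewrite gt_eqF.
have decrT : {homo arccot_branch b k : x y /~ (x < y)%R}.
  move=> x y xy; rewrite /arccot_branch ltrD2l ltrD2l ltrN2.
  by apply: lt_atan; rewrite ltr_pM2r ?invr_gt0.
exact: (integral_substitution_decr (@interval_is_interval _ _)
  (measurable_itv _) mS D0 cD TI SK dT decrT mh h0).
Qed.

End half_plane.

(** * The density of the image of dx dy / y^2 *)

Section transfer_density.
Context {R : realType}.
Local Notation mu := (@lebesgue_measure R).

Definition modulus (p : R * R) : R := Num.sqrt (p.1 ^+ 2 + p.2 ^+ 2).

(* For [p.2 != 0] these are [1 / (2 r (r - x))] and [1 / (2 r (r + x))]; in this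
   form both vanish on the real axis, since x / 0 = 0, so that [weightD] holds
   everywhere. *)
Definition transfer_weight (p : R * R) : R :=
  (modulus p + p.1) / (2 * modulus p * p.2 ^+ 2).

Definition gain_weight (p : R * R) : R :=
  (modulus p - p.1) / (2 * modulus p * p.2 ^+ 2).

Lemma modulus_ge0 p : 0 <= modulus p. Proof. exact: sqrtr_ge0. Qed.

Lemma ler_norm_modulus p : `|p.1| <= modulus p.
Proof.
by rewrite -sqrtr_sqr ler_sqrt ?addr_ge0 ?sqr_ge0// lerDl sqr_ge0.
Qed.

Lemma modulus_gt p : p.2 != 0 -> `|p.1| < modulus p.
Proof.
move=> p20; rewrite -sqrtr_sqr ltr_sqrt; last first.
  by rewrite ltr_wpDl ?sqr_ge0// exprn_even_gt0.
by rewrite ltrDl exprn_even_gt0.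
Qed.

Lemma transfer_weight_ge0 p : 0 <= transfer_weight p.
Proof.
have := ler_norm_modulus p; rewrite ler_norml => /andP[h _].
apply: divr_ge0; first by rewrite addrC -lerBlDr sub0r.
by rewrite mulr_ge0 ?sqr_ge0// mulr_ge0 ?modulus_ge0.
Qed.

Lemma gain_weight_ge0 p : 0 <= gain_weight p.
Proof.
have := ler_norm_modulus p; rewrite ler_norml => /andP[_ h].
apply: divr_ge0; first by rewrite subr_ge0.
by rewrite mulr_ge0 ?sqr_ge0// mulr_ge0 ?modulus_ge0.
Qed.

Lemma gain_weight_gt0 p : p.2 != 0 -> 0 < gain_weight p.
Proof.
move=> p20; have := modulus_gt p20; rewrite ltr_norml => /andP[h1 h2].
apply: divr_gt0; first by rewrite subr_gt0.
rewrite mulr_gt0 ?exprn_even_gt0// mulr_gt0//.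
by rewrite sqrtr_gt0 ltr_wpDl ?sqr_ge0// exprn_even_gt0.
Qed.

Lemma weightD p : transfer_weight p + gain_weight p = p.2 ^- 2.
Proof.
have [p20|p20] := eqVneq p.2 0.
  rewrite /transfer_weight /gain_weight p20 expr0n/=.
  by rewrite mulr0 invr0 !mulr0 addr0.
have := modulus_gt p20; rewrite /transfer_weight /gain_weight.
move: (modulus p) => r /(le_lt_trans (normr_ge0 _)) r0.
by field; rewrite p20 gt_eqF.
Qed.

(** The angle t = pi / 2 - atan (x / b) is the polar angle of (x, b), so cos t = x / r and sin^2 (t
    / 2) = (r - x) / (2 r). Multiplying 1 / (4 sin^2 (t / 2)) by b / r^2 gives b / (2 r (r - x)),
    and r^2 - x^2 = b^2 yields the form used in [transfer_weight]. *)
Lemma transfer_weight_branch (b x : R) : 0 < b ->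
  4^-1 * sin ((pi / 2 - atan (x / b)) / 2) ^- 2 * (b / (x ^+ 2 + b ^+ 2)) =
  b * transfer_weight (x, b).
Proof.
move=> b0; have b0' : b != 0 by rewrite gt_eqF.
set u := x / b; have xE : x = b * u by rewrite /u mulrC divfK.
set s := Num.sqrt (1 + u ^+ 2).
have s2 : s ^+ 2 = 1 + u ^+ 2 by rewrite sqr_sqrtr// addr_ge0// sqr_ge0.
have s0 : 0 < s by rewrite sqrtr_gt0 ltr_wpDr// sqr_ge0.
have modE : modulus (x, b) = b * s.
  rewrite /modulus/= xE exprMn -{2}(mulr1 (b ^+ 2)) -mulrDr addrC.
  by rewrite sqrtrM ?sqr_ge0// sqrtr_sqr gtr0_norm.
have sin2 (t : R) : sin (t / 2) ^+ 2 = (1 - cos t) / 2.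
  have -> : cos t = cos (t / 2 *+ 2) by rewrite mulr2n -splitr.
  by rewrite cos_mulr2n sin2cos2; field.
have us : s - u != 0.
  by rewrite subr_eq0; apply/eqP => su; move: s2; rewrite su; lra.
rewrite sin2 cosB cos_pihalf sin_pihalf mul0r mul1r add0r.
have -> : sin (atan u) = u / s.
  have c0 : cos (atan u) != 0 by rewrite cos_atan invr_eq0 gt_eqF.
  by rewrite -[in RHS](atanK u) /tan /s -cos_atan divfK.
rewrite /transfer_weight modE/= xE.
have -> : (b * u) ^+ 2 + b ^+ 2 = b ^+ 2 * s ^+ 2 by rewrite s2; ring.
have -> : b * s + b * u = b * (s ^+ 2 - u ^+ 2) / (s - u) by field.
rewrite [in RHS]s2 addrK.
by field; rewrite us b0' gt_eqF.
Qed.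

(** With v half the polar angle, the branches of index j and - (j + 1) take the values 2 (v + pi j)
    and - 2 (pi (j + 1) - v). Hence the pairing of [Posz k] with [Negz k]: each partial sum is a
    quarter of the one in [invr_sqr_sum_le]. *)
Lemma arccot_branch_sum_le (b x : R) : 0 < b ->
  (\sum_(k <oo) (arccot_branch b (Posz k) x ^- 2 +
                 arccot_branch b (Negz k) x ^- 2)%:E <=
   (4^-1 * sin ((pi / 2 - atan (x / b)) / 2) ^- 2)%:E)%E.
Proof.
move=> b0; have := atan_gtNpi2 (x / b); have := atan_ltpi2 (x / b).
set v := (pi / 2 - atan (x / b)) / 2 => h1 h2.
have v0 : 0 < v < pi by rewrite /v; lra.
apply: lime_le.
  apply: is_cvg_nneseries => k _ _.
  by rewrite lee_fin addr_ge0 ?invr_ge0 ?sqr_ge0.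
apply: nearW => n; rewrite sumEFin lee_fin big_mkord.
have sq2 (z : R) : (2 * z) ^- 2 = 4^-1 * z ^- 2.
  by rewrite exprMn invfM; congr (_^-1 * _); ring.
have vE : pi / 2 - atan (x / b) = 2 * v by rewrite /v; field.
rewrite (eq_bigr (fun j : 'I_n => 4^-1 *
    ((v + pi * j%:R) ^- 2 + (pi * j.+1%:R - v) ^- 2))); last first.
  move=> j _; rewrite /arccot_branch vE NegzE.
  have -> : 2 * pi * (Posz j)%:~R + 2 * v = 2 * (v + pi * j%:R) :> R.
    by rewrite -pmulrn; ring.
  have -> : 2 * pi * (- Posz j.+1)%:~R + 2 * v =
      - (2 * (pi * j.+1%:R - v)) :> R.
    by rewrite mulrNz -pmulrn; ring.
  by rewrite sqrrN !sq2 mulrDr.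
by rewrite -mulr_sumr ler_pM2l// invr_sqr_sum_le.
Qed.

Lemma sin_gt0_interval (y : R) : 0 < sin y ->
  exists k : int, y \in `](2 * pi * k%:~R), (2 * pi * k%:~R + pi)[.
Proof.
move=> sy; have pi0 := pi_gt0 R.
pose k := Num.floor (y / (2 * pi)); exists k.
have [t yt] : exists t, y = 2 * pi * k%:~R + t.
  by exists (y - 2 * pi * k%:~R); ring.
have := floor_itv (y / (2 * pi)); rewrite -/k => /andP[].
rewrite ler_pdivlMr ?mulr_gt0// ltr_pdivrMr ?mulr_gt0// intrD => h1 h2.
have t0 : 0 <= t by move: h1; rewrite yt; lra.
have t2 : t < 2 * pi by move: h2; rewrite yt; lra.
move: sy; rewrite yt sin_shift in_itv/= ltrDl ltrD2l => st.
apply/andP; split.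
  rewrite lt_neqAle t0 andbT; apply/eqP => te.
  by move: st; rewrite -te sin0 ltxx.
rewrite ltNge; apply/negP => pit; move: st; rewrite ltNge => /negP; apply.
have -> : t = (t - pi) + pi by ring.
by rewrite sinDpi oppr_le0 sin_ge0_pi//; lra.
Qed.

End transfer_density.

Section upper_half_plane.
Context {R : realType}.
Local Notation mu := (@lebesgue_measure R).
Local Open Scope ereal_scope.

Lemma measurable_cot (b : R) :
  measurable_fun setT (fun y : R => b * (cos y / sin y))%R.
Proof.
apply: measurable_funM => //; apply: measurable_funM.
  exact: measurable_cos.
by apply: measurableT_comp; [exact: measurable_invr|exact: measurable_sin].
Qed.

Lemma measurable_arccot_branch (b : R) k :
  measurable_fun setT (arccot_branch b k).
Proof.
apply: measurable_funD => //; apply: measurable_funB => //.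
apply: measurableT_comp; first exact: measurable_atan.
exact: mulrr_measurable.
Qed.

Lemma measurable_invr_sqr d (T : measurableType d) (f : T -> R) :
  measurable_fun setT f -> measurable_fun setT (fun x => (f x ^- 2)%:E).
Proof.
move=> mf; apply/measurable_EFinP; apply: measurableT_comp.
  exact: measurable_invr.
exact: measurable_funX.
Qed.

Lemma measurable_modulus : measurable_fun setT (@modulus R).
Proof.
apply: (@measurableT_comp _ _ _ _ _ _ (@Num.sqrt R)).
  by apply: continuous_measurable_fun; exact: sqrt_continuous.
by apply: measurable_funD; apply: measurable_funX.
Qed.

Lemma measurable_weight_denominator :
  measurable_fun setT (fun p : R * R => (2 * modulus p * p.2 ^+ 2)^-1)%R.
Proof.
apply: (measurableT_comp measurable_invr); apply: measurable_funM.
  by apply: measurable_funM => //; exact: measurable_modulus.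
exact: measurable_funX.
Qed.

Lemma measurable_transfer_weight : measurable_fun setT (@transfer_weight R).
Proof.
apply: measurable_funM measurable_weight_denominator.
by apply: measurable_funD => //; exact: measurable_modulus.
Qed.

Lemma measurable_gain_weight : measurable_fun setT (@gain_weight R).
Proof.
apply: measurable_funM measurable_weight_denominator.
by apply: measurable_funB => //; exact: measurable_modulus.
Qed.

(** The set sin y > 0 splits into the intervals ]2 k pi, (2k + 1) pi[. On each, x = b cot y turns 1
    / y^2 into the inverse square of the k-th branch; the sum over k is taken inside the integral
    and bounded by [arccot_branch_sum_le]. *)
Lemma integral_cot_le (b : R) (h : R -> \bar R) : (0 < b)%R ->
  measurable_fun setT h -> (forall y, 0 <= h y) ->
  \int[mu]_(y in [set y : R | (0 < sin y)%R])
    ((y ^- 2)%:E * h (b * (cos y / sin y))%R) <=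
  \int[mu]_x (h x * (b * transfer_weight (x, b))%:E).
Proof.
move=> b0 mh h0.
pose F (y : R) := (y ^- 2)%:E * h (b * (cos y / sin y))%R.
pose I (k : int) : set R :=
  `](2 * pi * k%:~R)%R, (2 * pi * k%:~R + pi)%R[%classic.
pose dens (x : R) := (b / (x ^+ 2 + b ^+ 2))%R.
have mF : measurable_fun setT F.
  apply: emeasurable_funM; first exact: measurable_invr_sqr.
  by apply: measurableT_comp => //; exact: measurable_cot.
have F0 y : 0 <= F y by rewrite mule_ge0// lee_fin invr_ge0 sqr_ge0.
have mI k : measurable (I k) by exact: measurable_itv.
have dens0 x : (0 <= dens x)%R.
  by rewrite divr_ge0 ?addr_ge0 ?sqr_ge0 ?ltW.
have mdens : measurable_fun setT dens.
  apply: measurable_funM => //; apply: measurableT_comp.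
    exact: measurable_invr.
  by apply: measurable_funD => //; exact: measurable_funX.
have IF k : \int[mu]_(y in I k) F y =
    \int[mu]_x (h x * (dens x)%:E * (arccot_branch b k x ^- 2)%:E).
  pose h' (x : R) := (arccot_branch b k x ^- 2)%:E * h x.
  transitivity (\int[mu]_(y in I k) h' (b * (cos y / sin y))%R).
    apply: eq_integral => y; rewrite inE => yI.
    by rewrite /h' arccot_branchK.
  rewrite integral_cot_subst//.
  - by apply: eq_integral => x _; rewrite /h' -muleA muleC.
  - apply: emeasurable_funM => //; apply: measurable_invr_sqr.
    exact: measurable_arccot_branch.
  - by move=> y; rewrite mule_ge0// lee_fin invr_ge0 sqr_ge0.
(* Grouping the indices k and - (k + 1) makes a series over the naturals run through all
   integers. *)
pose f (k : nat) y := (F \_ (I (Posz k))) y + (F \_ (I (Negz k))) y.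
have mFI k : measurable_fun setT (F \_ (I k)).
  by apply/(measurable_restrictT F (mI k)); exact: measurable_funTS.
have mf k : measurable_fun setT (f k).
  by apply: emeasurable_funD; exact: mFI.
have FI0 k y : 0 <= (F \_ (I k)) y by rewrite patchE; case: ifP.
have mS : measurable [set y : R | (0 < sin y)%R].
  rewrite -[X in measurable X]setTI.
  rewrite (_ : [set y | _] = sin @^-1` `]0%R, +oo[).
    exact: measurable_sin.
  by apply/seteqP; split => y; rewrite /= in_itv/= andbT.
(* Each y with sin y > 0 lies in some [I k], and the series of nonnegative terms dominates the term
   of that interval. *)
apply: (@le_trans _ _ (\int[mu]_y \sum_(k <oo) f k y)).
  rewrite integral_mkcond; apply: ge0_le_integral => //.
  - by move=> y _; rewrite patchE; case: ifP => // _; exact: F0.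
  - by apply/(measurable_restrictT F mS); exact: measurable_funTS.
  - apply: ge0_emeasurable_sum => // k; first by move=> y _ _; rewrite adde_ge0.
    by move=> _; exact: mf.
  - move=> y _; rewrite patchE; case: ifPn => [|_]; last first.
      by apply: nneseries_ge0 => k _ _; rewrite adde_ge0.
    rewrite inE => /sin_gt0_interval[k yI].
    have fk (j : nat) : f j y <= \sum_(k <oo) f k y.
      rewrite (nneseriesD1 (n := j))//; last by move=> i _; rewrite adde_ge0.
      by rewrite leeDl// nneseries_ge0// => i _ _; rewrite adde_ge0.
    have FE : (F \_ (I k)) y = F y by rewrite patchE mem_set.
    rewrite -/(F y) -FE; case: k {yI} FE => k _; apply: le_trans (fk k).
      by rewrite leeDl.
    by rewrite leeDr.
rewrite integral_nneseries//; last first.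
  by move=> k y _; rewrite adde_ge0.
pose c k x := (arccot_branch b (Posz k) x ^- 2 +
  arccot_branch b (Negz k) x ^- 2)%:E.
have c0 k x : 0 <= c k x.
  by rewrite lee_fin addr_ge0 ?invr_ge0 ?sqr_ge0.
have hd0 x : 0 <= h x * (dens x)%:E by rewrite mule_ge0// lee_fin.
have mhd : measurable_fun setT (fun x => h x * (dens x)%:E).
  by apply: emeasurable_funM => //; exact/measurable_EFinP.
have mc k : measurable_fun setT (c k).
  rewrite /c; under eq_fun do rewrite EFinD.
  by apply: emeasurable_funD; apply: measurable_invr_sqr;
    exact: measurable_arccot_branch.
rewrite (eq_eseriesr (g := fun k =>
  \int[mu]_x (h x * (dens x)%:E * c k x))); last first.
  move=> k _; rewrite /f ge0_integralD//; try exact: mFI.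
  have IF' i : \int[mu]_x (F \_ (I i)) x =
      \int[mu]_x (h x * (dens x)%:E * (arccot_branch b i x ^- 2)%:E).
    by rewrite -IF [RHS]integral_mkcond.
  rewrite !IF' -ge0_integralD//.
  - apply: eq_integral => x _; rewrite /c EFinD ge0_muleDr//.
      by rewrite lee_fin invr_ge0 sqr_ge0.
    by rewrite lee_fin invr_ge0 sqr_ge0.
  - by move=> x _; rewrite mule_ge0// lee_fin invr_ge0 sqr_ge0.
  - apply: emeasurable_funM => //; apply: measurable_invr_sqr.
    exact: measurable_arccot_branch.
  - by move=> x _; rewrite mule_ge0// lee_fin invr_ge0 sqr_ge0.
  - apply: emeasurable_funM => //; apply: measurable_invr_sqr.
    exact: measurable_arccot_branch.
have mhdc k : measurable_fun setT (fun x => h x * (dens x)%:E * c k x).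
  by apply: emeasurable_funM => //; exact: mc.
rewrite -integral_nneseries//; last first.
  by move=> k x _; rewrite mule_ge0.
apply: ge0_le_integral => //.
- by move=> x _; apply: nneseries_ge0 => k _ _; rewrite mule_ge0.
- apply: ge0_emeasurable_sum => // k; first by move=> y _ _; rewrite mule_ge0.
  by move=> _; exact: mhdc.
- apply: emeasurable_funM => //; apply/measurable_EFinP.
  apply: measurable_funM => //.
  apply: (measurableT_comp measurable_transfer_weight).
  exact: pair2_measurable.
- move=> x _; have -> : (b * transfer_weight (x, b))%:E = (dens x)%:E *
      (4^-1 * sin ((pi / 2 - atan (x / b)) / 2) ^- 2)%:E.
    by rewrite -transfer_weight_branch// EFinM muleC.
  rewrite muleA.
  apply: lime_le.
    by apply: is_cvg_nneseries => k _ _; rewrite mule_ge0.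
  apply: nearW => n; rewrite -ge0_sume_distrr; last by move=> k _; exact: c0.
  rewrite lee_wpmul2l//; apply: le_trans (arccot_branch_sum_le x b0).
  by apply: nneseries_lim_ge => k _ _; exact: c0.
Qed.

End upper_half_plane.

Section plane_transfer.
Context {R : realType}.
Local Notation mu := (@lebesgue_measure R).
Local Notation mu2 := (mu \x mu)%E.

Definition plane_exp (a : R) (p : R * R) : R * R :=
  (a * (expR p.1 * cos p.2), a * (expR p.1 * sin p.2)).

Lemma integral_oppr (h : R -> \bar R) : measurable_fun setT h ->
  (forall y, 0 <= h y)%E -> (\int[mu]_y h (- y)%R = \int[mu]_y h y)%E.
Proof.
move=> mh h0.
have iT : is_interval [set: R] by [].
have mN : measurable_fun setT (-%R : R -> R) by exact: oppr_measurable.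
have c1 : continuous (cst 1 : R -> R) by exact: cst_continuous.
have dN (x : R) : is_derive x 1 (-%R : R -> R) (- 1).
  exact: is_derive_eq.
have decrN : {homo (-%R : R -> R) : x y /~ x < y}.
  by move=> x y; rewrite ltrN2.
rewrite (integral_substitution_decr iT measurableT mN (fun=> ler01) c1
  (fun=> Logic.I) (fun y _ => opprK y) dN decrN mh h0).
by apply: eq_integral => x _; rewrite mule1.
Qed.

Lemma ae_sin_neq0 : {ae mu, forall y : R, sin y != 0}.
Proof.
have cZ : countable (range (fun k : int => pi * k%:~R : R)).
  exact: sub_countable (card_image_le _ _) (countableP _).
exists (range (fun k : int => pi * k%:~R)); split.
- exact: countable_measurable.
- exact: countable_lebesgue_measure0.
- move=> y /= /negP; rewrite negbK => /eqP sy.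
  have pi0 := pi_gt0 R; exists (Num.floor (y / pi)) => //.
  have := floor_itv (y / pi); move: (Num.floor _) => k /andP[].
  rewrite ler_pdivlMr// ltr_pdivrMr// intrD => h1 h2.
  have [t yt] : exists t, y = t + pi * k%:~R by exists (y - pi * k%:~R); ring.
  move: h1 h2 sy; rewrite {}yt => h1 h2 sy.
  (* Squaring removes the sign in sin (z + pi) = - sin z, so pi becomes a period and the parity of k
     is irrelevant. *)
  have : sin t ^+ 2 = 0.
    rewrite -(@periodicz R R (fun y => sin y ^+ 2) pi k t).
      by rewrite sy expr0n.
    by move=> z; rewrite sinDpi sqrrN.
  move=> /eqP; rewrite sqrf_eq0 => /eqP st.
  have [t0|t0] := eqVneq t 0; first by rewrite t0 add0r.
  have : 0 < sin t by rewrite sin_gt0_pi// lt_neqAle eq_sym t0/=; lra.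
  by rewrite st ltxx.
Qed.

Local Open Scope ereal_scope.

Lemma integral_mul_indic d (T : measurableType d)
    (m : {measure set T -> \bar R}) (D : set T) (f : T -> \bar R) :
  \int[m]_(x in D) f x = \int[m]_x ((\1_D x)%:E * f x).
Proof.
rewrite integral_mkcond; apply: eq_integral => x _.
by rewrite epatch_indic muleC.
Qed.

Lemma measurable_plane_exp d (T : measurableType d) (a : T -> R)
    (p : T -> R * R) : measurable_fun setT a -> measurable_fun setT p ->
  measurable_fun setT (fun t => plane_exp (a t) (p t)).
Proof.
move=> ma mp; have mp1 : measurable_fun setT (fst \o p).
  exact: measurableT_comp.
have mp2 : measurable_fun setT (snd \o p) by exact: measurableT_comp.
have mep : measurable_fun setT (fun t => expR (p t).1).
  by apply: (measurableT_comp (@measurable_expR R)).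
apply: measurable_fun_pair; apply: measurable_funM => //;
  apply: measurable_funM => //.
- exact: (measurableT_comp measurable_cos mp2).
- exact: (measurableT_comp measurable_sin mp2).
Qed.

Let S : set R := [set y | (0 < sin y)%R].
Let P : set R := [set y | (0 < y)%R].

Let mS : measurable S.
Proof.
rewrite -[X in measurable X]setTI (_ : S = sin @^-1` `]0%R, +oo[).
  exact: measurable_sin.
by apply/seteqP; split => y; rewrite /S /= in_itv/= andbT.
Qed.

Let mP : measurable P.
Proof.
rewrite (_ : P = `]0%R, +oo[%classic)//.
by apply/seteqP; split => y; rewrite /P /= in_itv/= andbT.
Qed.

Let m1S : measurable_fun setT (\1_S : R -> R).
Proof. exact: measurable_indic. Qed.

Let m1P : measurable_fun setT (\1_P : R -> R).
Proof. exact: measurable_indic. Qed.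

(** The points with sin y > 0 are those mapped into the upper half-plane. The planar change of
    variables is made one coordinate at a time: for fixed y substitute b = a sin y e^x, where dx =
    db / b makes a disappear; then exchange the integrals and, for fixed b, substitute x = b cot
    y. *)
Lemma transfer_upper (a : R) (g : R * R -> \bar R) : (0 < a)%R ->
  measurable_fun setT g -> (forall p, 0 <= g p) ->
  \int[mu]_y ((\1_S y * y ^- 2)%:E * \int[mu]_x g (plane_exp a (x, y))) <=
  \int[mu]_y \int[mu]_x
    ((\1_P y)%:E * (g (x, y) * (transfer_weight (x, y))%:E)).
Proof.
move=> a0 mg g0.
(* The integrand in the intermediate coordinates (y, b): y is the imaginary part of the source
   point, b that of its image. *)
pose f (q : R * R) := (\1_S q.1 * q.1 ^- 2 * (\1_P q.2 * q.2^-1))%:E *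
  g (q.2 * (cos q.1 / sin q.1), q.2)%R.
have PE b : b \in P -> \1_P b = 1%R by rewrite indicE => ->.
have P0 b : b \notin P -> \1_P b = 0%R by rewrite indicE => /negbTE ->.
have Pinv0 b : (0 <= \1_P b * b^-1 :> R)%R.
  have [bP|/P0 ->] := boolP (b \in P); last by rewrite mul0r.
  by rewrite PE// mul1r invr_ge0 ltW//; move: bP; rewrite inE.
have mPinv : measurable_fun setT (fun b : R => \1_P b * b^-1)%R.
  by apply: measurable_funM => //; exact: measurable_invr.
have f0 q : 0 <= f q.
  rewrite mule_ge0// lee_fin mulr_ge0//.
  by rewrite mulr_ge0 ?invr_ge0 ?sqr_ge0.
have mcot : measurable_fun setT (fun q : R * R => q.2 * (cos q.1 / sin q.1))%R.
  apply: measurable_funM => //; apply: measurable_funM.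
    exact: (measurableT_comp measurable_cos).
  apply: (measurableT_comp measurable_invr).
  exact: (measurableT_comp measurable_sin).
have mf : measurable_fun setT f.
  apply: emeasurable_funM; last first.
    by apply: (measurableT_comp mg); exact: measurable_fun_pair.
  apply/measurable_EFinP; apply: measurable_funM; last first.
    exact: (measurableT_comp mPinv).
  apply: measurable_funM; first exact: (measurableT_comp m1S).
  by apply: (measurableT_comp measurable_invr); exact: measurable_funX.
have -> : \int[mu]_y ((\1_S y * y ^- 2)%:E * \int[mu]_x g (plane_exp a (x, y)))
    = \int[mu]_y \int[mu]_b f (y, b).
  apply: eq_integral => y _; rewrite /f/=.
  pose G (b : R) := g (b * (cos y / sin y), b)%R.
  have mG : measurable_fun setT G.
    apply: (measurableT_comp mg); apply: measurable_fun_pair => //.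
    exact: mulrr_measurable.
  have [yS|yS] := boolP (y \in S); last first.
    rewrite indicE (negbTE yS) mul0r mul0e.
    by rewrite integral0_eq// => b _; rewrite !mul0r mul0e.
  have sy : (0 < sin y)%R by move: yS; rewrite inE.
  rewrite indicE yS mul1r.
  under [RHS]eq_integral do rewrite EFinM -muleA.
  rewrite ge0_integralZl_EFin//; last 3 first.
  - by move=> b _; rewrite mule_ge0// lee_fin.
  - by apply: emeasurable_funM => //; exact/measurable_EFinP.
  - by rewrite invr_ge0 sqr_ge0.
  congr (_ * _); transitivity (\int[mu]_x G (a * sin y * expR x)%R).
    apply: eq_integral => x _; congr (g (_, _)); last by rewrite /=; ring.
    by rewrite /=; field; rewrite gt_eqF.
  rewrite (integral_exp_subst (mulr_gt0 a0 sy) mG (fun=> g0 _)).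
  rewrite (integral_mul_indic mu).
  apply: eq_integral => b _; rewrite EFinM -muleA; congr (_ * _).
    by rewrite !indicE; congr ((nat_of_bool _)%:R%:E);
      apply/idP/idP; rewrite !inE /P/= in_itv/= andbT.
  exact: muleC.
pose F (p : R * R) :=
  (\1_P p.2)%:E * (g p * (transfer_weight p)%:E).
have F0 p : 0 <= F p.
  by rewrite mule_ge0 ?mule_ge0// lee_fin transfer_weight_ge0.
have mF : measurable_fun setT F.
  apply: emeasurable_funM.
    by apply/measurable_EFinP; exact: (measurableT_comp m1P).
  apply: emeasurable_funM => //; apply/measurable_EFinP.
  exact: measurable_transfer_weight.
(* After the exchange, [integral_cot_le] applies for fixed b to x |-> g (x, b) / b, whose factor 1 /
   b cancels the b in front of [transfer_weight]. *)
rewrite (@fubini_tonelli _ _ _ _ _ mu mu f)//; apply: ge0_le_integral => //.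
- by move=> b _; exact: integral_ge0.
- exact: measurable_fun_fubini_tonelli_G.
- exact: (@measurable_fun_fubini_tonelli_G _ _ _ _ _ mu F mF F0).
- move=> b _; rewrite /f/=.
  have [bP|bP] := boolP (b \in P); last first.
    rewrite [leLHS]integral0_eq; last first.
      by move=> y _; rewrite P0// mul0r mulr0 mul0e.
    apply: integral_ge0 => x _; rewrite mule_ge0 ?mule_ge0// ?lee_fin//.
    exact: transfer_weight_ge0.
  have b0 : (0 < b)%R by move: bP; rewrite inE.
  have mgb : measurable_fun setT (fun x => g (x, b) * (b^-1)%:E).
    apply: emeasurable_funM => //; apply: (measurableT_comp mg).
    exact: pair2_measurable.
  have gb0 x : 0 <= g (x, b) * (b^-1)%:E.
    by rewrite mule_ge0// lee_fin invr_ge0 ltW.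
  have := integral_cot_le b0 mgb gb0.
  rewrite integral_mul_indic; congr (_ <= _); apply: eq_integral => x _.
    by rewrite PE// mul1r !EFinM -!muleA [g _ * _]muleC.
  by rewrite PE// mul1e -muleA -EFinM mulrA mulVf ?mul1r// gt_eqF.
Qed.

End plane_transfer.

Section plane_transfer_le.
Context {R : realType}.
Local Notation mu := (@lebesgue_measure R).
Local Notation mu2 := (mu \x mu)%E.
Local Open Scope ereal_scope.

(** The part sin y > 0 is [transfer_upper]. The part sin y < 0 follows by complex conjugation, which
    commutes with [plane_exp a] and preserves both weights. *)
Lemma integral_transfer_le (a : R) (g : R * R -> \bar R) : (0 < a)%R ->
  measurable_fun setT g -> (forall p, 0 <= g p) ->
  \int[mu2]_p (g (plane_exp a p) * (p.2 ^- 2)%:E) <=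
  \int[mu2]_p (g p * (transfer_weight p)%:E).
Proof.
move=> a0 mg g0.
pose S : set R := [set y | (0 < sin y)%R].
pose P : set R := [set y | (0 < y)%R].
have mS : measurable_fun setT (\1_S : R -> R).
  apply: measurable_indic; rewrite -[X in measurable X]setTI.
  rewrite (_ : S = sin @^-1` `]0%R, +oo[); first exact: measurable_sin.
  by apply/seteqP; split => y; rewrite /S /= in_itv/= andbT.
have mP : measurable_fun setT (\1_P : R -> R).
  apply: measurable_indic; rewrite (_ : P = `]0%R, +oo[%classic)//.
  by apply/seteqP; split => y; rewrite /P /= in_itv/= andbT.
have mN : measurable_fun setT (-%R : R -> R) by exact: oppr_measurable.
pose conj (p : R * R) : R * R := (p.1, - p.2)%R.
have mconj : measurable_fun setT conj.
  by apply: measurable_fun_pair => //; exact: (measurableT_comp mN).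
have mgc : measurable_fun setT (g \o conj) by exact: measurableT_comp.
have mfa : measurable_fun setT (plane_exp a).
  exact: (@measurable_plane_exp _ _ _ (cst a) id).
pose slice (h : R * R -> \bar R) (y : R) := \int[mu]_x h (x, y).
have mslice h : measurable_fun setT h -> (forall p, 0 <= h p) ->
    measurable_fun setT (slice h).
  by move=> mh h0; exact: (@measurable_fun_fubini_tonelli_G _ _ _ _ _ mu h).
have slice0 h y : (forall p, 0 <= h p) -> 0 <= slice h y.
  by move=> h0; exact: integral_ge0.
have swap h : measurable_fun setT h -> (forall p, 0 <= h p) ->
    \int[mu2]_p h p = \int[mu]_y slice h y.
  move=> mh h0.
  rewrite (@fubini_tonelli1 _ _ _ _ _ mu mu h mh h0).
  exact: (@fubini_tonelli _ _ _ _ _ mu mu h mh h0).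
have mw : measurable_fun setT (fun p => (@transfer_weight R p)%:E).
  by apply/measurable_EFinP; exact: measurable_transfer_weight.
have w0 p : 0 <= (@transfer_weight R p)%:E.
  by rewrite lee_fin transfer_weight_ge0.
have mq : measurable_fun setT (fun y : R => (y ^- 2)%:E).
  exact: measurable_invr_sqr.
have q0 y : 0 <= (y ^- 2)%:E :> \bar R by rewrite lee_fin invr_ge0 sqr_ge0.
pose G := slice (g \o plane_exp a).
have mG : measurable_fun setT G.
  by apply: mslice; [exact: measurableT_comp|move=> p; exact: g0].
have G0 y : 0 <= G y by apply: slice0 => p; exact: g0.
pose K := slice (fun p => g p * (transfer_weight p)%:E).
have gw0 p : 0 <= g p * (transfer_weight p)%:E by rewrite mule_ge0.
have mgw : measurable_fun setT (fun p => g p * (transfer_weight p)%:E).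
  exact: emeasurable_funM.
have mK : measurable_fun setT K by exact: mslice.
have K0 y : 0 <= K y by exact: slice0.
have mgq : measurable_fun setT (fun p => g (plane_exp a p) * (p.2 ^- 2)%:E).
  apply: emeasurable_funM; first exact: measurableT_comp.
  exact: measurable_invr_sqr.
have gq0 p : 0 <= g (plane_exp a p) * (p.2 ^- 2)%:E by rewrite mule_ge0.
rewrite [leLHS](swap _ mgq gq0).
rewrite [leRHS](swap _ mgw gw0) -/K.
have -> : \int[mu]_y slice (fun p => g (plane_exp a p) * (p.2 ^- 2)%:E) y =
    \int[mu]_y ((y ^- 2)%:E * G y).
  apply: eq_integral => y _; rewrite /slice/= muleC -ge0_integralZr//.
    apply: measurableT_comp mg _; apply: measurableT_comp mfa _.
    exact: pair2_measurable.
  by move=> x _; exact: g0.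
have mSq : measurable_fun setT (fun y : R => (\1_S y * y ^- 2)%:E).
  apply/measurable_EFinP; apply: measurable_funM => //.
  exact/measurable_EFinP.
have Sq0 : forall z : R, 0 <= (\1_S z * z ^- 2)%:E.
  by move=> z; rewrite lee_fin mulr_ge0 ?invr_ge0 ?sqr_ge0.
(* [H] is the upper integrand for the conjugate function; by [HN], z |-> H (- z) is the contribution
   of the lines with sin z < 0. *)
pose H (y : R) := (\1_S y * y ^- 2)%:E * slice (g \o conj \o plane_exp a) y.
have mH : measurable_fun setT H.
  apply: emeasurable_funM => //; apply: mslice => [|p]; last exact: g0.
  exact: measurableT_comp.
have H0 y : 0 <= H y by rewrite mule_ge0// slice0// => p; exact: g0.
have HN : forall z : R, H (- z)%R = (\1_S (- z)%R * z ^- 2)%:E * G z.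
  move=> z; rewrite /H sqrrN; congr (_ * _); apply: eq_integral => x _.
  by rewrite /= /conj /plane_exp/= cosN sinN !mulrN opprK.
(* The two indicators together cover every y with sin y != 0, that is, almost every y. *)
apply: (@le_trans _ _ (\int[mu]_y ((\1_S y * y ^- 2)%:E * G y) +
    \int[mu]_y H (- y)%R)).
  have mSG : measurable_fun setT (fun y : R => (\1_S y * y ^- 2)%:E * G y).
    exact: emeasurable_funM.
  have mHN : measurable_fun setT (fun y : R => H (- y)%R).
    exact: (measurableT_comp mH).
  have SG0 z : 0 <= (\1_S z * z ^- 2)%:E * G z by rewrite mule_ge0.
  rewrite -ge0_integralD//; apply: ae_ge0_le_integral => //.
  - by move=> y _; rewrite mule_ge0.
  - exact: emeasurable_funM.
  - by move=> y _; rewrite adde_ge0.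
  - exact: emeasurable_funD.
  - apply: (negligibleS _ (@ae_sin_neq0 R)) => y /=; apply: contra_not.
    rewrite neq_lt => /orP[sy|sy] _.
      rewrite HN [\1_S (- y)%R]indicE (@mem_set _ _ (- y)%R) ?mul1r ?leeDr//.
      by rewrite /S/= sinN oppr_gt0.
    by rewrite [\1_S y]indicE mem_set// mul1r leeDl.
rewrite integral_oppr//.
have PK : forall (h : R * R -> \bar R) (y : R),
  measurable_fun setT h -> (forall p, 0 <= h p) ->
  \int[mu]_x ((\1_P y)%:E * h (x, y)) = (\1_P y)%:E * slice h y.
  move=> h y mh h0; rewrite ge0_integralZl_EFin//.
  by apply: (measurableT_comp mh); exact: pair2_measurable.
have mgcw : measurable_fun setT
    (fun p => (g \o conj) p * (transfer_weight p)%:E).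
  exact: emeasurable_funM.
have gcw0 p : 0 <= (g \o conj) p * (transfer_weight p)%:E.
  by rewrite mule_ge0//; exact: g0.
pose L (y : R) := (\1_P y)%:E *
  slice (fun p => (g \o conj) p * (transfer_weight p)%:E) y.
have mP' : measurable_fun setT (fun y : R => (\1_P y)%:E : \bar R).
  exact/measurable_EFinP.
have mL : measurable_fun setT L.
  by apply: emeasurable_funM => //; exact: mslice.
have L0 y : 0 <= L y by rewrite mule_ge0// slice0.
have LN : forall z : R, L (- z)%R = (\1_P (- z)%R)%:E * K z.
  move=> z; rewrite /L; congr (_ * _); apply: eq_integral => x _.
  by rewrite /= /conj/= opprK /transfer_weight /modulus/= sqrrN.
have up : \int[mu]_y ((\1_S y * y ^- 2)%:E * G y) <=
    \int[mu]_y ((\1_P y)%:E * K y).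
  apply: le_trans (transfer_upper a0 mg g0) _.
  rewrite le_eqVlt; apply/orP; left; apply/eqP; apply: eq_integral => y _.
  exact: PK mgw gw0.
have down : \int[mu]_y H y <= \int[mu]_y L (- y)%R.
  rewrite (integral_oppr mL L0).
  apply: le_trans (transfer_upper a0 mgc (fun p => g0 (conj p))) _.
  rewrite le_eqVlt; apply/orP; left; apply/eqP; apply: eq_integral => y _.
  exact: PK mgcw gcw0.
have PK0 z : 0 <= (\1_P z)%:E * K z by rewrite mule_ge0.
have mPK : measurable_fun setT (fun y : R => (\1_P y)%:E * K y).
  exact: emeasurable_funM.
have mLN : measurable_fun setT (fun y : R => L (- y)%R).
  exact: (measurableT_comp mL).
apply: le_trans (leeD up down) _; rewrite -ge0_integralD//.
apply: ge0_le_integral => //.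
- by move=> y _; rewrite adde_ge0.
- exact: emeasurable_funD.
(* The two image half-planes are disjoint, so their indicators add up to at most 1. *)
- move=> y _; rewrite LN -ge0_muleDl ?lee_fin// -[leRHS]mul1e.
  rewrite lee_wpmul2r// -EFinD lee_fin !indicE.
  have [yP|_] := boolP (y \in P); have [yN|_] := boolP (- y \in P)%R => //=.
  by move: yP yN; rewrite !inE /P/= oppr_gt0 => /lt_trans h /h; rewrite ltxx.
Qed.

End plane_transfer_le.

(** * Visits of the skew product *)

Section plane_lebesgue.
Context {R : realType}.
Local Open Scope ereal_scope.

(* An alias, because sigma-finiteness of a product measure is inferred only for
   subprobabilities. *)
Definition plane_lebesgue :
    set (measurableTypeR R * measurableTypeR R) -> \bar R :=
  (@lebesgue_measure R \x @lebesgue_measure R).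

HB.instance Definition _ := Measure.on plane_lebesgue.

Let sigma_finite_plane_lebesgue : sigma_finite setT plane_lebesgue.
Proof.
pose I n : set (measurableTypeR R) := `](- n%:R)%R, (n%:R)%R]%classic.
have mI n : measurable (I n) by exact: measurable_itv.
have Ix (x : R) n : (Num.truncn `|x| < n)%N -> I n x.
  move=> xn; have : (`|x| < n%:R)%R.
    by rewrite (lt_le_trans (truncnS_gt _))// ler_nat.
  by rewrite ltr_norml /I/= in_itv/= => /andP[-> /ltW ->].
exists (fun n => I n `*` I n).
  apply/esym; rewrite -subTset => -[x y] _.
  exists (maxn (Num.truncn `|x|) (Num.truncn `|y|)).+1 => //.
  by split; apply: Ix; rewrite ltnS ?leq_maxl ?leq_maxr.
move=> n; split; first exact: measurableX.
have Ioo : lebesgue_measure (I n) < +oo.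
  by rewrite /I lebesgue_measure_itv/=; case: ifP => _; rewrite ltry.
by rewrite /plane_lebesgue product_measure1E// lte_mul_pinfty// ge0_fin_numE.
Qed.

HB.instance Definition _ := Measure_isSigmaFinite.Build _ _ _ plane_lebesgue
  sigma_finite_plane_lebesgue.

End plane_lebesgue.

Section skew_product.
Context {R : realType} {d : measure_display} {Omega : measurableType d}.
Variables (m : probability Omega R) (theta : Omega -> Omega) (eta : Omega -> R).
Hypothesis theta_preserving : measure_preserving m theta.
Hypothesis eta_gt0 : forall w, (0 < eta w)%R.
Hypothesis meta : measurable_fun setT eta.
Local Notation mu := (@lebesgue_measure R).
Local Notation mu2 := (mu \x mu)%E.
Local Open Scope ereal_scope.

(** Adding the gain to [integral_transfer_le] completes the weight to 1 / y^2 by [weightD]. The loss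
    of mass is written as a sum, since the integrals may be infinite. *)
Lemma integral_transfer_gain (a : R) (g : R * R -> \bar R) : (0 < a)%R ->
  measurable_fun setT g -> (forall p, 0 <= g p) ->
  \int[mu2]_p (g (plane_exp a p) * (p.2 ^- 2)%:E) +
  \int[mu2]_p (g p * (gain_weight p)%:E) <=
  \int[mu2]_p (g p * (p.2 ^- 2)%:E).
Proof.
move=> a0 mg g0; have mw (f : R * R -> R) : measurable_fun setT f ->
    measurable_fun setT (fun p => g p * (f p)%:E).
  by move=> mf; apply: emeasurable_funM => //; exact/measurable_EFinP.
apply: (le_trans (leeD2r _ (integral_transfer_le a0 mg g0))).
rewrite -ge0_integralD//.
- rewrite le_eqVlt; apply/orP; left; apply/eqP; apply: eq_integral => p _.
  rewrite -ge0_muleDr ?lee_fin ?transfer_weight_ge0 ?gain_weight_ge0//.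
  by congr (_ * _); rewrite -weightD EFinD.
- by move=> p _; rewrite mule_ge0// lee_fin transfer_weight_ge0.
- by apply: mw; exact: measurable_transfer_weight.
- by move=> p _; rewrite mule_ge0// lee_fin gain_weight_ge0.
- by apply: mw; exact: measurable_gain_weight.
Qed.

Lemma integral_preserving (f : Omega -> \bar R) :
  measurable_fun setT f -> (forall w, 0 <= f w) ->
  \int[m]_w f (theta w) = \int[m]_w f w.
Proof.
case: theta_preserving => mt tP mf f0.
transitivity (\int[m]_(w in setT) (f w * (cst 1%R w)%:E)); last first.
  by apply: eq_integral => w _; rewrite mule1.
apply: (@ge0_integral_transfer _ _ _ _ _ m m setT theta (cst 1%R)) => // E mE.
rewrite setTI tP//.
by rewrite /= integral_cst// mul1e.
Qed.

(** The skew product over [theta] acts on the plane and not on the cylinder, because dx dy / y^2 is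
    not invariant under translation by 2 pi i. *)
Definition skew (q : Omega * (R * R)) : Omega * (R * R) :=
  (theta q.1, plane_exp (eta q.1) q.2).

Lemma measurable_skew : measurable_fun setT skew.
Proof.
have [mt _] := theta_preserving.
apply: measurable_fun_pair; first exact: (measurableT_comp mt).
by apply: measurable_plane_exp => //; exact: (measurableT_comp meta).
Qed.

Definition weighted (W : R * R -> R) (G : Omega * (R * R) -> \bar R) :=
  \int[m]_w \int[mu2]_p (G (w, p) * (W p)%:E).

Lemma measurable_weighted_slice (W : R * R -> R)
    (G : Omega * (R * R) -> \bar R) :
  measurable_fun setT W -> (forall p, (0 <= W p)%R) ->
  measurable_fun setT G -> (forall q, 0 <= G q) ->
  measurable_fun setT (fun w => \int[mu2]_p (G (w, p) * (W p)%:E)).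
Proof.
move=> mW W0 mG G0.
pose H (q : Omega * (R * R)) := G q * (W q.2)%:E.
have mH : measurable_fun setT H.
  apply: emeasurable_funM => //; apply/measurable_EFinP.
  exact: (measurableT_comp mW).
have H0 q : 0 <= H q by rewrite mule_ge0// lee_fin.
exact: (@measurable_fun_fubini_tonelli_F _ _ _ _ _ (@plane_lebesgue R) H mH H0).
Qed.

(** In the fibre over w this is [integral_transfer_gain] with a = eta w and the slice of [G] at
    theta w. Invariance of [m] replaces w by theta w in the two terms that contain [G] without the
    skew product. *)
Lemma weighted_skew_le (G : Omega * (R * R) -> \bar R) :
  measurable_fun setT G -> (forall q, 0 <= G q) ->
  weighted (fun p => p.2 ^- 2)%R (G \o skew) + weighted (@gain_weight R) G <=
  weighted (fun p => p.2 ^- 2)%R G.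
Proof.
move=> mG G0.
have mq : measurable_fun setT (fun p : R * R => p.2 ^- 2)%R.
  exact/measurable_EFinP/measurable_invr_sqr.
have q0 (p : R * R) : (0 <= p.2 ^- 2)%R by rewrite invr_ge0 sqr_ge0.
have gain0 := @gain_weight_ge0 R.
have sgain := measurable_weighted_slice (@measurable_gain_weight R) gain0 mG G0.
have sq := measurable_weighted_slice mq q0 mG G0.
have mGs : measurable_fun setT (G \o skew).
  exact: (measurableT_comp mG measurable_skew).
have [mt _] := theta_preserving.
rewrite /weighted.
rewrite -(integral_preserving sgain); last first.
  by move=> w; apply: integral_ge0 => p _; rewrite mule_ge0// lee_fin.
rewrite -(integral_preserving sq); last first.
  by move=> w; apply: integral_ge0 => p _; rewrite mule_ge0// lee_fin.
have mGg := measurableT_comp sgain mt.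
have mGq := measurableT_comp sq mt.
have mGsq := measurable_weighted_slice mq q0 mGs (fun q => G0 (skew q)).
rewrite -ge0_integralD//; last 2 first.
- by move=> w _; apply: integral_ge0 => p _; rewrite mule_ge0// ?lee_fin//=.
- by move=> w _; apply: integral_ge0 => p _; rewrite mule_ge0// lee_fin.
apply: ge0_le_integral => //.
- move=> w _; rewrite adde_ge0//; apply: integral_ge0 => p _;
    rewrite mule_ge0// ?lee_fin//=.
- exact: emeasurable_funD.
- move=> w _; have mg : measurable_fun setT (fun p => G (theta w, p)).
    by apply: (measurableT_comp mG); exact: pair1_measurable.
  exact: (integral_transfer_gain (eta_gt0 w) mg (fun p => G0 _)).
Qed.

(** Telescoping: [weighted_skew_le], applied to [G] along the iterates, loses one gain term at each
    step, and all losses are paid from the initial mass. *)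
Lemma weighted_visits_le (G : Omega * (R * R) -> \bar R) n :
  measurable_fun setT G -> (forall q, 0 <= G q) ->
  weighted (fun p => p.2 ^- 2)%R (G \o iter n skew) +
  \sum_(i < n) weighted (@gain_weight R) (G \o iter i skew) <=
  weighted (fun p => p.2 ^- 2)%R G.
Proof.
move=> mG G0; elim: n => [|n IH]; first by rewrite big_ord0 adde0.
apply: le_trans IH.
have miter k : measurable_fun setT (iter k skew).
  elim: k => [|k IH]; first exact: measurable_id.
  exact: measurableT_comp measurable_skew IH.
rewrite big_ord_recr/= addeA addeAC; apply: leeD2r.
have -> : G \o (fun q => skew (iter n skew q)) = (G \o iter n skew) \o skew.
  by apply/funext => q /=; rewrite -iterS iterSr.
apply: weighted_skew_le; first exact: measurableT_comp.
by move=> q; exact: G0.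
Qed.

End skew_product.

(** * Sets away from the half-axis receive finite mass *)

Section off_axis.
Context {R : realType}.
Local Notation mu := (@lebesgue_measure R).
Local Notation mu2 := (mu \x mu)%E.

(* Periodic lifts of sets exhausting the complement of [0, +oo[ in the
   cylinder. *)
Definition off_axis (N e : R) : set (R * R) :=
  [set p | `|p.1| <= N /\ (e <= 1 - cos p.2 \/ p.1 <= - e)].

Lemma oneB_cos_le (y : R) : 1 - cos y <= y ^+ 2 / 2.
Proof.
have -> : cos y = cos (y / 2 *+ 2) by rewrite mulr2n -splitr.
rewrite cos_mulr2n cos2sin2.
have : sin (y / 2) ^+ 2 <= (y / 2) ^+ 2.
  rewrite -[leLHS]real_normK ?num_real// -[leRHS]real_normK ?num_real//.
  by rewrite ler_pXn2r ?nnegrE// norm_sin_le.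
rewrite expr_div_n; have -> : 2 ^+ 2 = 4 :> R by rewrite -natrX.
by rewrite (mulr2n (1 - _)); lra.
Qed.

(** If 1 - cos y >= e, then y^2 >= 2 e >= e^2 and the bound 1 / y^2 is enough. If x <= - e, the
    weight 1 / (2 r (r - x)) is at most 1 / r^2, while r^2 >= y^2 and r^2 >= e^2. The right-hand
    side is written as the density of [integral_cot_subst] for b = 1. *)
Lemma transfer_weight_off_axis (N e : R) p : 0 < e <= 1 -> off_axis N e p ->
  transfer_weight p <= (1 + e ^- 2) * (1 / (p.2 ^+ 2 + 1 ^+ 2)).
Proof.
case: p => x y /andP[e0 e1] [_ /= H]; rewrite expr1n div1r.
have y10 : 0 < y ^+ 2 + 1 by rewrite ltr_wpDl ?sqr_ge0.
have c0 : 0 <= (1 + e ^- 2) / (y ^+ 2 + 1).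
  by rewrite divr_ge0 ?addr_ge0 ?invr_ge0 ?sqr_ge0// ltW.
(* On the real axis the weight is 0 by the convention on division by 0. *)
have [->|y0] := eqVneq y 0.
  rewrite /transfer_weight/= [0 ^+ 2]expr0n/= mulr0 invr0 mulr0.
  by rewrite divr_ge0 ?addr_ge0 ?invr_ge0 ?sqr_ge0.
have y20 : 0 < y ^+ 2 by rewrite exprn_even_gt0.
have e20 : 0 < e ^+ 2 by rewrite exprn_gt0.
case: H => H.
  have ye : 2 * e <= y ^+ 2 by have := oneB_cos_le y; lra.
  apply: (@le_trans _ _ (y ^- 2)).
    by rewrite -(@weightD R (x, y)) lerDl gain_weight_ge0.
  rewrite ler_pdivlMr// mulrDr mulVf ?gt_eqF// mulr1 lerD2l.
  rewrite lef_pV2 ?posrE//; apply: le_trans ye.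
  by rewrite expr2 ler_pM2r//; lra.
have := modulus_gt (p := (x, y)) y0; rewrite /= ltr_norml => /andP[rx1 rx2].
have r2 : modulus (x, y) ^+ 2 = x ^+ 2 + y ^+ 2.
  by rewrite sqr_sqrtr// addr_ge0 ?sqr_ge0.
rewrite /transfer_weight/=; move: (modulus _) rx1 rx2 r2 => r rx1 rx2 r2.
have r0 : 0 < r by lra.
have -> : (r + x) / (2 * r * y ^+ 2) = (2 * r * (r - x))^-1.
  have -> : y ^+ 2 = (r + x) * (r - x) by rewrite mulrC -subr_sqr r2; ring.
  by field; rewrite !gt_eqF//; lra.
rewrite ler_pdivlMr// mulrC ler_pdivrMr ?mulr_gt0//; last by lra.
have xe : e ^+ 2 <= x ^+ 2.
  by rewrite -[leRHS]sqrrN ler_pXn2r ?nnegrE//; lra.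
have rxx : r ^+ 2 <= 2 * r * (r - x).
  have : 0 <= r * (- x) by rewrite mulr_ge0//; lra.
  have := sqr_ge0 r; rewrite expr2; lra.
have : (1 + e ^- 2) * r ^+ 2 <= (1 + e ^- 2) * (2 * r * (r - x)).
  by rewrite ler_pM2l// ltr_wpDr// invr_ge0 ltW.
apply: le_trans; rewrite mulrDl mul1r r2.
have : 1 <= e ^- 2 * (x ^+ 2 + y ^+ 2).
  by rewrite mulrC ler_pdivlMr// mul1r; have := sqr_ge0 y; lra.
by have := sqr_ge0 x; lra.
Qed.

Lemma measurable_off_axis (N e : R) : measurable (off_axis N e).
Proof.
have m1 : measurable [set p : R * R | `|p.1| <= N].
  have mn : measurable_fun setT (fun p : R * R => `|p.1|).
    by apply: measurableT_comp => //; exact: normr_measurable.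
  have := measurable_fun_ler mn (measurable_cst N).
  by move=> /(_ measurableT [set true] Logic.I); rewrite setTI.
have m2 : measurable [set p : R * R | e <= 1 - cos p.2].
  have mn : measurable_fun setT (fun p : R * R => 1 - cos p.2).
    by apply: measurable_funB => //; exact: (measurableT_comp measurable_cos).
  have := measurable_fun_ler (measurable_cst e) mn.
  by move=> /(_ measurableT [set true] Logic.I); rewrite setTI.
have m3 : measurable [set p : R * R | p.1 <= - e].
  have := measurable_fun_ler (@measurable_fst _ _ R R) (measurable_cst (- e)).
  by move=> /(_ measurableT [set true] Logic.I); rewrite setTI.
rewrite (_ : off_axis N e = [set p | `|p.1| <= N] `&`
  ([set p | e <= 1 - cos p.2] `|` [set p | p.1 <= - e])) //.
by apply: measurableI => //; exact: measurableU.
Qed.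

Local Open Scope ereal_scope.

(** The total mass is the length of ]0, pi[, by [integral_cot_subst] with h = 1, b = 1 and k = 0. *)
Lemma integral_cauchy_density :
  \int[mu]_x (1 / (x ^+ 2 + 1 ^+ 2))%:E = (@pi R)%:E.
Proof.
transitivity (\int[mu]_x (cst 1 x * (1 / (x ^+ 2 + 1 ^+ 2))%:E)).
  by apply: eq_integral => x _; rewrite mul1e.
rewrite -(@integral_cot_subst R 1 0 (cst 1))//.
rewrite integral_cst; last exact: measurable_itv.
rewrite mul1e -[LHS]/(mu _) lebesgue_measure_itv/= mulr0 add0r lte_fin pi_gt0.
by rewrite -EFinB subr0.
Qed.

(** The weight on the set is dominated by a product: the indicator of [- N, N] in x and a multiple
    of the Cauchy density in y, both integrable. *)
Lemma integral_off_axis_lty (N e : R) : (0 < e <= 1)%R ->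
  \int[mu2]_p ((\1_(off_axis N e) p)%:E * (transfer_weight p)%:E) < +oo.
Proof.
move=> e01; pose C := (1 + e ^- 2)%R.
have C0 : (0 <= C)%R by rewrite addr_ge0 ?invr_ge0 ?sqr_ge0.
pose c (y : R) := (1 / (y ^+ 2 + 1 ^+ 2))%R.
have c0 y : (0 <= c y)%R by rewrite divr_ge0 ?addr_ge0 ?sqr_ge0.
have mc : measurable_fun setT c.
  apply: measurable_funM => //; apply: (measurableT_comp measurable_invr).
  by apply: measurable_funD => //; exact: measurable_funX.
pose I : set R := `[(- N)%R, N]%classic.
have Ioo : mu I < +oo.
  by rewrite /I lebesgue_measure_itv/=; case: ifP => _; rewrite ltry.
have mI : measurable I by exact: measurable_itv.
have m1I : measurable_fun setT (\1_I : R -> R) by exact: measurable_indic.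
pose f (p : R * R) := (\1_I p.1)%:E * (C * c p.2)%:E.
have mCc : measurable_fun setT (fun y => (C * c y)%:E).
  by apply/measurable_EFinP; exact: measurable_funM.
have Cc0 y : 0 <= (C * c y)%:E by rewrite lee_fin mulr_ge0.
have mcE : measurable_fun setT (EFin \o c) by exact/measurable_EFinP.
have f0 p : 0 <= f p by apply: mule_ge0; rewrite lee_fin// mulr_ge0.
have mf : measurable_fun setT f.
  apply: emeasurable_funM; last exact: (measurableT_comp mCc).
  apply/measurable_EFinP; exact: (measurableT_comp m1I).
apply: (@le_lt_trans _ _ (\int[mu2]_p f p)).
  apply: ge0_le_integral => //.
  - by move=> p _; rewrite mule_ge0 ?lee_fin ?transfer_weight_ge0.
  - apply: emeasurable_funM; apply/measurable_EFinP.
      by apply: measurable_indic; exact: measurable_off_axis.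
    exact: measurable_transfer_weight.
  - move=> p _; have [pK|pK] := boolP (p \in off_axis N e); last first.
      by rewrite indicE (negbTE pK) mul0e.
    rewrite indicE pK mul1e /f indicE mem_set.
      rewrite mul1e lee_fin; apply: transfer_weight_off_axis e01 _.
      exact: set_mem pK.
    by move: pK; rewrite inE => -[+ _]; rewrite ler_norml /I/= in_itv.
rewrite (@fubini_tonelli1 _ _ _ _ _ mu mu f mf f0).
apply: (@le_lt_trans _ _ (\int[mu]_x ((\1_I x)%:E * (C * pi)%:E))).
  rewrite le_eqVlt; apply/orP; left; apply/eqP; apply: eq_integral => x _.
  transitivity (\int[mu]_y ((\1_I x)%:E * (C * c y)%:E)) => //.
  rewrite (@ge0_integralZl_EFin _ _ _ mu setT measurableT _
    (fun y _ => Cc0 y) mCc)//.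
  congr (_ * _); rewrite EFinM -integral_cauchy_density.
  exact: (@ge0_integralZl_EFin _ _ _ mu setT measurableT (EFin \o c)
    (fun y _ => c0 y) mcE).
rewrite ge0_integralZr//; last 2 first.
- exact/measurable_EFinP.
- by rewrite lee_fin mulr_ge0// pi_ge0.
rewrite integral_indic// setIT.
by apply: lte_mul_pinfty; rewrite ?ge0_fin_numE ?ltry.
Qed.

Lemma ae_im_neq0 : {ae mu2, forall p : R * R, p.2 != 0%R}.
Proof.
exists (setT `*` [set 0%R]); split.
- exact: measurableX.
- by rewrite product_measure1E//= lebesgue_measure_set1 mule0.
- by move=> p /= /negP; rewrite negbK => /eqP.
Qed.

(** The tails of a finite series tend to 0; once a tail is below 1 it contains no visit, as each
    visit contributes 1. *)
Lemma nneseries_indic_finite (T : Type) (K : set T) (x : nat -> T) :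
  \sum_(i <oo) (\1_K (x i))%:E < +oo :> \bar R ->
  exists N, forall n, (N <= n)%N -> ~ K (x n).
Proof.
move=> Soo; have u0 (i : nat) : 0 <= (\1_K (x i))%:E :> \bar R.
  by rewrite lee_fin.
have tail := nneseries_tail_cvg Soo (fun k _ => u0 k).
have nb : nbhs (0 : \bar R) [set y | y < 1].
  apply: open_nbhs_nbhs; split; last by rewrite /= lte_fin.
  exact: open_ereal_lt_ereal.
have [N _ NP] := tail _ nb.
exists N => n Nn Kn; have := NP N (leqnn N); rewrite /= ltNge => /negP; apply.
apply: le_trans (nneseries_lim_ge n.+1 _) => //.
rewrite big_nat_recr//= [X in _ + X](_ : _ = 1); last first.
  by rewrite indicE mem_set.
by rewrite leeDr// sume_ge0.
Qed.

End off_axis.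

Section finite_visits.
Context {R : realType} {d : measure_display} {Omega : measurableType d}.
Variables (m : probability Omega R) (theta : Omega -> Omega) (eta : Omega -> R).
Hypothesis theta_preserving : measure_preserving m theta.
Hypothesis eta_gt0 : forall w, (0 < eta w)%R.
Hypothesis meta : measurable_fun setT eta.
Local Notation mu := (@lebesgue_measure R).
Local Notation mu2 := (mu \x mu)%E.
Local Notation T := (skew theta eta).
Local Open Scope ereal_scope.

Lemma measurable_iter_skew n : measurable_fun setT (iter n T).
Proof.
elim: n => [|n IH]; first exact: measurable_id.
exact: measurableT_comp (measurable_skew theta_preserving meta) IH.
Qed.

(* Borel-Cantelli, for the infinite measure with density [gain_weight]. *)
Lemma ae_finite_visits (K : set (R * R)) : measurable K ->
  \int[mu2]_p ((\1_K p)%:E * (transfer_weight p)%:E) < +oo ->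
  {ae m, forall w, {ae mu2, forall p,
    exists N, forall n, (N <= n)%N -> ~ K (iter n.+1 T (w, p)).2}}.
Proof.
move=> mK finK.
set C := \int[mu2]_p _ in finK.
pose gK (p : R * R) : \bar R := (\1_K p)%:E.
have gK0 p : 0 <= gK p by rewrite lee_fin.
have mgK : measurable_fun setT gK.
  by apply/measurable_EFinP; exact: measurable_indic.
(* Visits are counted from time 1 on: it is the mass arriving in [K] after one step, at most [C],
   that is known to be finite. This is the origin of [n.+1] in the conclusion. *)
pose G (q : Omega * (R * R)) := gK (T q).2.
have mT := measurable_skew theta_preserving meta.
have mG : measurable_fun setT G.
  apply: (measurableT_comp mgK); apply: (measurableT_comp _ mT).
  exact: measurable_snd.
have G0 q : 0 <= G q by exact: gK0.
pose u i := G \o iter i T.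
have mu_ i : measurable_fun setT (u i).
  exact: measurableT_comp mG (measurable_iter_skew i).
have u0 i q : 0 <= u i q by exact: G0.
have mgain := @measurable_gain_weight R.
have gain0 := @gain_weight_ge0 R.
have GC : weighted m (fun p => p.2 ^- 2)%R G <= C.
  apply: (@le_trans _ _ (\int[m]_w (cst C w))).
    apply: ge0_le_integral => //.
    - move=> w _; apply: integral_ge0 => p _.
      by rewrite mule_ge0// lee_fin invr_ge0 sqr_ge0.
    - apply: measurable_weighted_slice => //.
        exact/measurable_EFinP/measurable_invr_sqr.
      by move=> p; rewrite invr_ge0 sqr_ge0.
    - by move=> w _; exact: (integral_transfer_le (eta_gt0 w) mgK gK0).
  by rewrite integral_cst//= -[X in C * X]/(m setT) probability_setT mule1.
have uC n : \sum_(i < n) weighted m (@gain_weight R) (u i) <= C.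
  apply: le_trans GC.
  apply: le_trans
    (weighted_visits_le theta_preserving eta_gt0 meta n mG G0).
  rewrite leeDr//; apply: integral_ge0 => w _; apply: integral_ge0 => p _.
  by apply: mule_ge0; [exact: G0|rewrite lee_fin invr_ge0 sqr_ge0].
pose U q := \sum_(i <oo) u i q.
have U0 q : 0 <= U q by apply: nneseries_ge0 => i _ _; exact: u0.
have mU : measurable_fun setT U.
  by apply: ge0_emeasurable_sum => // i q _ _; exact: u0.
pose Phi w := \int[mu2]_p (U (w, p) * (gain_weight p)%:E).
have Phi0 w : 0 <= Phi w.
  by apply: integral_ge0 => p _; rewrite mule_ge0// lee_fin.
have mPhi : measurable_fun setT Phi by exact: measurable_weighted_slice.
have mslice i := measurable_weighted_slice mgain gain0 (mu_ i) (u0 i).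
have PhiE w :
    Phi w = \sum_(i <oo) \int[mu2]_p (u i (w, p) * (gain_weight p)%:E).
  rewrite -integral_nneseries//.
  - apply: eq_integral => p _; rewrite /U muleC -nneseriesZl; last first.
      by move=> i _; exact: u0.
    by apply: eq_eseriesr => i _; rewrite muleC.
  - move=> i; apply: emeasurable_funM.
      by apply: (measurableT_comp (mu_ i)); exact: pair1_measurable.
    exact/measurable_EFinP.
  - by move=> i p _; rewrite mule_ge0// lee_fin.
have Phi_lty : \int[m]_w Phi w < +oo.
  apply: (@le_lt_trans _ _ C); last exact: finK.
  under eq_integral do rewrite PhiE.
  rewrite integral_nneseries//; last first.
    by move=> i w _; apply: integral_ge0 => p _; rewrite mule_ge0// lee_fin.
  apply: lime_le.
    apply: is_cvg_nneseries => i _ _; apply: integral_ge0 => w _.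
    by apply: integral_ge0 => p _; rewrite mule_ge0// lee_fin.
  by apply: nearW => n; rewrite big_mkord; exact: uC.
have iPhi : m.-integrable setT Phi.
  apply/integrableP; split => //.
  by under eq_integral do rewrite gee0_abs//.
(* Finiteness almost everywhere is used twice: first for [Phi] on [Omega], then, for a fixed good w,
   for the weighted number of visits on the plane. *)
have := integrable_ae measurableT iPhi; apply: filterS => w /(_ Logic.I) Pw.
have mUw : measurable_fun setT (fun p => U (w, p) * (gain_weight p)%:E).
  apply: emeasurable_funM.
    by apply: (measurableT_comp mU); exact: pair1_measurable.
  exact/measurable_EFinP.
have iUw : mu2.-integrable setT (fun p => U (w, p) * (gain_weight p)%:E).
  apply/integrableP; split => //.
  under eq_integral do rewrite gee0_abs ?mule_ge0 ?lee_fin//.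
  by move: Pw; rewrite ge0_fin_numE.
have aeU := integrable_ae measurableT iUw.
have [N1 [mN1 N10 sN1]] := aeU; have [N2 [mN2 N20 sN2]] := @ae_im_neq0 R.
exists (N1 `|` N2); split.
- exact: measurableU.
- by rewrite [LHS](measureU0 mN1 mN2 N20).
- move=> p; apply: contra_notP => /not_orP[pN1 pN2].
  have p0 : p.2 != 0%R by apply: contrapT => h; apply: pN2; exact: sN2.
  have Up : U (w, p) * (gain_weight p)%:E \is a fin_num.
    by apply: contrapT => h; apply: pN1; apply: sN1 => /= /(_ Logic.I).
  (* Off the real axis [gain_weight] is positive, so an infinite number of visits would make the
     product infinite. *)
  have {}Up : U (w, p) < +oo.
    rewrite ltey; apply/eqP => Uy; move: Up.
    by rewrite Uy gt0_mulye// lte_fin gain_weight_gt0.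
  exact: (@nneseries_indic_finite R _ K (fun n => (iter n.+1 T (w, p)).2) Up).
Qed.

End finite_visits.

(** * Orbits on the cylinder *)

Section cylinder_orbits.
Context {R : realType}.
Local Notation Q := (cylinder R).
Local Notation Re := (@complex.Re R).
Local Notation Im := (@complex.Im R).
Local Open Scope complex_scope.
Local Open Scope quotient_scope.

(** The imaginary part is not defined on the cylinder, but its cosine is: a continuous function that
    equals 1 exactly on the image of the real line. *)
Definition cyl_cos (q : Q) : R := cos (Im (repr q)).

Lemma cyl_cos_pi (z : R[i]) : cyl_cos (cyl_pi z) = cos (Im z).
Proof.
have /cyl_piP[k] : cyl_pi (repr (cyl_pi z)) = cyl_pi z by exact: reprK.
rewrite /cyl_cos; case: (repr _) => u v; case: z => c d [/= _ /eqP].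
rewrite subr_eq addrC => /eqP ->.
by apply: periodicz => y; rewrite mulrC mulr_natr cosD2pi.
Qed.

Lemma cyl_Re_F_exp (a : R) (q : Q) :
  cyl_Re (F_exp a q) = a * (expR (cyl_Re q) * cyl_cos q).
Proof.
by rewrite /F_exp cyl_Re_pi /f_exp /cexp /= !mul0r subr0.
Qed.

Lemma normc_Im_le (z : R[i]) : (`|Im z|)%:C <= `|z|.
Proof.
rewrite normc_def lecR -sqrtr_sqr ler_sqrt; last by rewrite addr_ge0 ?sqr_ge0.
by rewrite lerDr sqr_ge0.
Qed.

Lemma Im_continuous : continuous Im.
Proof.
move=> z U /nbhs_ballP[e /= e0 eU].
apply/nbhs_ballP; exists e%:C; first by rewrite /= ltcR.
move=> w zw; apply: eU; rewrite /ball/=.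
rewrite -ltcR; apply: le_lt_trans zw.
rewrite -[X in `|X|](_ : Im (z - w) = _) ?normc_Im_le//.
by case: (z) (w) => ? ? [].
Qed.

Lemma cyl_cos_continuous : continuous cyl_cos.
Proof.
apply/quotient_continuous.
have -> : cyl_cos \o \pi_Q = @cos R \o Im.
  by apply/funext => z; exact: cyl_cos_pi.
move=> z; apply: continuous_comp; first exact: Im_continuous.
exact: continuous_cos.
Qed.

Definition cyl_off_axis (N e : R) : set Q :=
  [set q | `|cyl_Re q| <= N /\ (e <= 1 - cyl_cos q \/ cyl_Re q <= - e)].

Lemma cyl_off_axis_plane (N e : R) p :
  cyl_off_axis N e (plane_to_cyl p) = off_axis N e p.
Proof.
by rewrite /cyl_off_axis /off_axis /plane_to_cyl /= cyl_Re_pi cyl_cos_pi.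
Qed.

Lemma F_exp_plane (a : R) p :
  F_exp a (plane_to_cyl p) = plane_to_cyl (plane_exp a p).
Proof.
rewrite /plane_to_cyl F_exp_pi /f_exp /cexp /plane_exp/=; congr cyl_pi.
by apply/eqP; rewrite eq_complex/= !mul0r subr0 addr0 !eqxx.
Qed.

Lemma rand_iter_plane d (Omega : measurableType d) (theta : Omega -> Omega)
    (eta : Omega -> R) n w p :
  rand_iter theta eta n w (plane_to_cyl p) =
  plane_to_cyl (iter n (skew theta eta) (w, p)).2.
Proof.
have iter1 k : (iter k (skew theta eta) (w, p)).1 = iter k theta w.
  by elim: k => //= k ->.
by elim: n => //= n ->; rewrite F_exp_plane iter1.
Qed.

Lemma cos_eq1 (y : R) : cos y = 1 -> exists k : int, y = 2 * pi * k%:~R.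
Proof.
have pi0 := pi_gt0 R; move=> cy.
have := floor_itv (y / (2 * pi)); move: (Num.floor _) => k /andP[].
rewrite ler_pdivlMr ?mulr_gt0// ltr_pdivrMr ?mulr_gt0// intrD => h1 h2.
have [t yt] : exists t, y = 2 * pi * k%:~R + t.
  by exists (y - 2 * pi * k%:~R); ring.
exists k; move: h1 h2 cy; rewrite {}yt cos_shift => h1 h2 ct.
have [->|t0] := eqVneq t 0; first by rewrite addr0.
have : 0 < sin (t / 2).
  have tge0 : 0 <= t by lra.
  have tgt0 : 0 < t by rewrite lt_neqAle eq_sym t0.
  by rewrite sin_gt0_pi//; lra.
have : cos t = cos (t / 2 *+ 2) by rewrite mulr2n -splitr.
rewrite ct cos_mulr2n cos2sin2 => E s0.
have : 0 < sin (t / 2) ^+ 2 by rewrite exprn_gt0.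
by move: E; rewrite (mulr2n (1 - _)); lra.
Qed.

Lemma cyl_nonneg_axis (q : Q) : 0 <= cyl_Re q -> cyl_cos q = 1 ->
  nonneg_axis (CylFin q).
Proof.
move=> q0 /cos_eq1[k ik]; left; exists (cyl_Re q) => //=; congr CylFin.
rewrite -[RHS]reprK; apply/esym/cyl_piP; exists k.
rewrite /cyl_Re -ik; case: (repr q) => x y /=.
by apply/eqP; rewrite eq_complex/= subrr subr0 !eqxx.
Qed.

Section eventually_on_axis.
Variables (A B : R) (a : nat -> R) (u : nat -> Q).
Hypotheses (A_gt : (expR 1)^-1 < A) (aAB : forall n, A <= a n <= B).
Hypothesis uS : forall n, u n.+1 = F_exp (a n) (u n).
Hypothesis u_off : forall j : nat, exists N, forall n, (N <= n)%N ->
  ~ cyl_off_axis j.+1%:R j.+1%:R^-1 (u n).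

(** A point of the cylinder off the half-axis has a neighbourhood inside one of the sets
    [cyl_off_axis], which the sequence eventually avoids. *)
Lemma accumulation_points_axis :
  accumulation_points u `<=` nonneg_axis `|` [set CylMinf].
Proof.
move=> [q| |] qu; [left|by right|by left; right].
apply: contrapT => qaxis.
have [j [qN qe]] : exists j : nat, `|cyl_Re q| < j.+1%:R /\
    (j.+1%:R^-1 < 1 - cyl_cos q \/ cyl_Re q < - j.+1%:R^-1).
  have [b b0 qb] : exists2 b : R, 0 < b & b <= 1 - cyl_cos q \/ cyl_Re q <= - b.
    have [q0|q0] := leP 0 (cyl_Re q); last first.
      by exists (- cyl_Re q); [rewrite oppr_gt0|right; rewrite opprK].
    exists (1 - cyl_cos q); last by left.
    rewrite subr_gt0 lt_neqAle cos_le1 andbT; apply/eqP => cq.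
    exact/qaxis/cyl_nonneg_axis.
  (* Then j + 1 exceeds both |Re q| and 1 / b, which gives the two strict inequalities at once. *)
  exists (Num.truncn (`|cyl_Re q| + b^-1)); set j := Num.truncn _.
  have jb : `|cyl_Re q| + b^-1 < j.+1%:R by exact: truncnS_gt.
  have bV : 0 < b^-1 by rewrite invr_gt0.
  have qj := normr_ge0 (cyl_Re q).
  split; first by lra.
  have jb' : j.+1%:R^-1 < b.
    by rewrite invf_plt ?posrE// ?ltr0n//; lra.
  case: qb => qb; [left; exact: lt_le_trans qb|right].
  by apply: le_lt_trans qb _; rewrite ltrN2.
have [N Nu] := u_off j.
(* Strict inequalities make [V] open; it lies inside the corresponding [cyl_off_axis]. *)
pose V : set (ecylinder R) := [set x | if x is CylFin q' then
  `|cyl_Re q'| < j.+1%:R /\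
  (j.+1%:R^-1 < 1 - cyl_cos q' \/ cyl_Re q' < - j.+1%:R^-1) else False].
have nV : nbhs (CylFin q) V.
  apply: open_nbhs_nbhs; split=> //; rewrite ecyl_openE; split=> //=.
  apply: openI; [|apply: openU].
  - apply: (@open_comp _ _ (fun q' => `|cyl_Re q'|) [set x : R | x < j.+1%:R]).
      move=> q' _; apply: continuous_comp; first exact: cyl_Re_continuous.
      exact: norm_continuous.
    exact: open_lt.
  - apply: (@open_comp _ _ (fun q' => 1 - cyl_cos q')
        [set x : R | j.+1%:R^-1 < x]).
      move=> q' _; apply: continuousB; first exact: cst_continuous.
      exact: cyl_cos_continuous.
    exact: open_gt.
  - apply: (@open_comp _ _ (@cyl_Re R) [set x : R | x < - j.+1%:R^-1]).
      by move=> q' _; exact: cyl_Re_continuous.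
    exact: open_lt.
have tailA : ((fun n => CylFin (u n)) @ \oo)
    [set x | exists2 n, (N <= n)%N & x = CylFin (u n)].
  by exists N => // n /= Nn; exists n.
have [_ [[n Nn ->] /= [un1 un2]]] := qu _ _ tailA nV.
apply: (Nu n Nn); split; first exact: ltW.
by case: un2 => /ltW; [left|right].
Qed.

(** If the real parts stayed below M, then eventually each point would have real part below - L or a
    cosine above 1 - 1 / L. The first case leads back to real part at least - L in one step; in the
    second the real part grows by a fixed c > 0, and so without bound. *)
Lemma unbounded_Re (M : R) N : exists2 n, (N <= n)%N & M < cyl_Re (u n).
Proof.
apply: contrapT => nex.
have xM n : (N <= n)%N -> cyl_Re (u n) <= M.
  by move=> Nn; rewrite leNgt; apply/negP => Mx; apply: nex; exists n.
have A0 : 0 < A by rewrite (lt_trans _ A_gt)// invr_gt0 expR_gt0.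
have dA : 0 < A - (expR 1)^-1 by rewrite subr_gt0.
(* The three summands ensure M <= L, B <= L and A (1 - 1 / L) > 1 / e. *)
pose j := Num.truncn (`|M| + `|B| + A / (A - (expR 1)^-1)).
have jP : `|M| + `|B| + A / (A - (expR 1)^-1) < j.+1%:R by exact: truncnS_gt.
set L : R := j.+1%:R in jP.
have AdA : 0 < A / (A - (expR 1)^-1) by rewrite divr_gt0.
have M0 := normr_ge0 M; have B0 := normr_ge0 B.
have ML : M <= L by have := ler_norm M; lra.
have BL : B <= L by have := ler_norm B; lra.
have L0 : 0 < L by lra.
(* [A'] is the factor left after the loss in the cosine. From A' e^x >= x + 1 + ln A' the increment
   is c = 1 + ln A', positive exactly when A' > 1 / e. *)
pose A' := A * (1 - L^-1).
have A'e : (expR 1)^-1 < A'.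
  rewrite /A' mulrBr mulr1 ltrBrDr -ltrBrDl -/(A / L) ltr_pdivrMr//.
  by rewrite -ltr_pdivrMl// mulrC; lra.
have A'0 : 0 < A' by rewrite (lt_trans _ A'e)// invr_gt0 expR_gt0.
pose c := ln A' + 1.
have c0 : 0 < c.
  have : ln (expR 1)^-1 < ln A' by rewrite ltr_ln// posrE invr_gt0 expR_gt0.
  by rewrite lnV ?posrE ?expR_gt0// expRK /c; lra.
have [N' N'u] := u_off j.
pose n1 := maxn N N'.
have step n : (n1 <= n)%N -> - L <= cyl_Re (u n) ->
    cyl_Re (u n) + c <= cyl_Re (u n.+1).
  rewrite geq_max => /andP[Nn N'n] xL.
  have := N'u n N'n; rewrite /cyl_off_axis/= -/L => /not_andP[].
    by rewrite ler_norml xL (le_trans (xM n Nn) ML).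
  move=> /not_orP[/negP + _]; rewrite -ltNge => cosn.
  rewrite uS cyl_Re_F_exp; apply: (@le_trans _ _ (A' * expR (cyl_Re (u n)))).
    rewrite -{1}(lnK A'0) -expRD; have := expR_ge1Dx (ln A' + cyl_Re (u n)).
    by apply: le_trans; rewrite /c; lra.
  have /andP[aA _] := aAB n.
  have -> : A' * expR (cyl_Re (u n)) = A * (expR (cyl_Re (u n)) * (1 - L^-1)).
    by rewrite /A'; ring.
  apply: ler_pM => //; first exact: ltW.
    by rewrite mulr_ge0 ?expR_ge0// subr_ge0 invf_le1// ler1n.
  by rewrite ler_pM2l ?expR_gt0// lerBlDr -lerBlDl ltW.
(* From real part below - L < 0 the exponential is at most 1, so the next real part is at least - B
   >= - L. *)
have [n2 n12 xn2] : exists2 n2, (n1 <= n2)%N & - L <= cyl_Re (u n2).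
  have [xL|xL] := leP (- L) (cyl_Re (u n1)); first by exists n1.
  exists n1.+1 => //; rewrite uS cyl_Re_F_exp.
  have /andP[aA aB] := aAB n1; have a0 : 0 < a n1 by lra.
  have ex0 := expR_gt0 (cyl_Re (u n1)).
  have ex1 : expR (cyl_Re (u n1)) <= 1 by rewrite expR_le1; lra.
  have : - expR (cyl_Re (u n1)) <= expR (cyl_Re (u n1)) * cyl_cos (u n1).
    by rewrite -mulrN1 ler_pM2l// cos_geN1.
  move=> h; have : a n1 * -1 <= a n1 * (expR (cyl_Re (u n1)) * cyl_cos (u n1)).
    by rewrite ler_pM2l//; lra.
  by lra.
(* As each step increases the real part, it remains at least - L and [step] applies again. *)
have grow k : cyl_Re (u n2) + k%:R * c <= cyl_Re (u (n2 + k)%N).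
  elim: k => [|k IH]; first by rewrite mul0r addr0 addn0.
  have kc : 0 <= k%:R * c by rewrite mulr_ge0// ltW.
  have := step (n2 + k)%N (leq_trans n12 (leq_addr _ _)).
  by rewrite addnS -natr1 mulrDl mul1r => /(_ _)H; have := H; lra.
pose k := (Num.truncn ((M - cyl_Re (u n2)) / c)).+1.
have : (M - cyl_Re (u n2)) / c < k%:R by exact: truncnS_gt.
rewrite ltr_pdivrMr// => kM; have := grow k.
have /xM : (N <= n2 + k)%N.
  by rewrite (leq_trans _ (leq_addr _ _))// (leq_trans _ n12)// leq_maxl.
by lra.
Qed.

Lemma accumulation_points_CylPinf : CylPinf \in accumulation_points u.
Proof.
rewrite inE => S U [N _ NS]; rewrite nbhsE => -[V [+ Vp] VU].
rewrite ecyl_openE => -[_ _ /(_ Vp)[M VM]].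
have [n Nn Mn] := unbounded_Re M N.
by exists (CylFin (u n)); split; [exact: NS|exact/VU/VM].
Qed.

End eventually_on_axis.
End cylinder_orbits.

(** * From null sets of the plane to null sets of the cylinder *)

Section cylinder_null_sets.
Context {R : realType}.
Local Notation mu2 := ((@lebesgue_measure R) \x (@lebesgue_measure R))%E.

(** The mass of [E] is the area of the part of its lift lying in one fundamental strip, hence at
    most the area of the whole lift. *)
Lemma negligible_cylinder (E : set (cylinder R)) :
  measurable (plane_to_cyl @^-1` E) -> mu2.-negligible (plane_to_cyl @^-1` E) ->
  cyl_lebesgue.-negligible E.
Proof.
move=> mE nE; exists E; split => //.
have E0 : mu2 (plane_to_cyl @^-1` E) = 0%E by exact: measure_negligible.
rewrite /cyl_lebesgue /pushforward /mrestr/=.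
apply/eqP; rewrite eq_le measure_ge0 andbT -E0 le_measure// inE//.
by apply: measurableI => //; exact: measurable_strip.
Qed.

End cylinder_null_sets.

Unset Implicit Arguments.

Theorem corollary6 (R : realType) (d : measure_display)
    (Omega : measurableType d) (m : probability Omega R)
    (theta theta' : Omega -> Omega) (A B : R) (eta : Omega -> R)
    (m_complete : measure_is_complete m)
    (thetaK : cancel theta theta') (theta'K : cancel theta' theta)
    (theta'_measurable : measurable_fun [set: Omega] theta')
    (theta_preserving : measure_preserving m theta)
    (theta_ergodic : ergodic m theta)
    (A_gt : (expR 1)^-1 < A) (AB : A < B)
    (eta_measurable : measurable_fun [set: Omega] eta)
    (eta_AB : forall w : Omega, A <= eta w <= B) :
  {ae m, forall w : Omega, exists Qw : set (cylinder R),
    cyl_lebesgue.-negligible (~` Qw) /\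
    forall z : cylinder R, Qw z ->
      accumulation_points (fun n : nat => rand_iter theta eta n w z)
        `<=` nonneg_axis `|` [set CylMinf] /\
      CylPinf \in accumulation_points
        (fun n : nat => rand_iter theta eta n w z)}.
Proof.
have A0 : 0 < A by rewrite (lt_trans _ A_gt)// invr_gt0 expR_gt0.
have eta_gt0 w : 0 < eta w.
  by have /andP[+ _] := eta_AB w; exact: lt_le_trans.
pose L (j : nat) : R := j.+1%:R.
have L01 j : 0 < (L j)^-1 <= 1.
  by rewrite invr_gt0 ltr0Sn/= invf_le1 ?ltr0Sn// ler1n.
(* Countably many parameters j suffice to exhaust the complement of the half-axis, so a single null
   set of w serves them all. *)
have visits : {ae m, forall w, forall j : nat,
    {ae (@lebesgue_measure R \x @lebesgue_measure R)%E, forall p,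
    exists N, forall n, (N <= n)%N ->
      ~ off_axis (L j) (L j)^-1 (iter n.+1 (skew theta eta) (w, p)).2}}.
  apply: ae_foralln => j; apply: ae_finite_visits => //.
    exact: measurable_off_axis.
  exact: integral_off_axis_lty.
apply: filterS visits => w visits.
pose Qw : set (cylinder R) := [set z | forall j : nat, exists N, forall n,
  (N <= n)%N -> ~ cyl_off_axis (L j) (L j)^-1 (rand_iter theta eta n w z)].
exists Qw; split; last first.
  move=> z zQ; pose a n := eta (iter n theta w).
  have aAB n : A <= a n <= B by exact: eta_AB.
  split.
    exact: (accumulation_points_axis zQ).
  exact: (accumulation_points_CylPinf A_gt aAB (fun=> erefl) zQ).
pose bad j n : set (R * R) :=
  [set p | off_axis (L j) (L j)^-1 (iter n (skew theta eta) (w, p)).2].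
(* The lift of the exceptional set is the union over j of the upper limits of the sets [bad j n],
   which shows that it is measurable. *)
have QwE : plane_to_cyl @^-1` (~` Qw) =
    \bigcup_j \bigcap_N \bigcup_(n in [set n | (N <= n)%N]) bad j n.
  apply/seteqP; split => p /=.
    move=> /existsNP[j /forallNP nj]; exists j => // N _.
    have /existsNP[n /not_implyP[Nn /contrapT]] := nj N.
    by rewrite rand_iter_plane cyl_off_axis_plane => Kn; exists n.
  move=> [j _ nj] /(_ j)[N NP]; have [n /= Nn] := nj N Logic.I.
  by have := NP n Nn; rewrite rand_iter_plane cyl_off_axis_plane => nK /nK.
apply: negligible_cylinder.
  rewrite QwE; apply: bigcup_measurable => j _.
  apply: bigcap_measurable => [|N _]; first by exists 0%N.
  apply: bigcup_measurable => n _.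
  have miter : measurable_fun setT
      (fun p : R * R => (iter n (skew theta eta) (w, p)).2).
    apply: (measurableT_comp (@measurable_snd _ _ Omega (R * R)%type)).
    apply: (measurableT_comp
      (measurable_iter_skew theta_preserving eta_measurable n)).
    exact: pair1_measurable.
  rewrite -[X in measurable X]setTI; apply: miter => //.
  exact: measurable_off_axis.
rewrite QwE; apply: negligible_bigcup => j.
apply: negligibleS (visits j) => p /= pj [N NP].
(* The bound N concerns times n + 1, so a visit at a time at least N + 1 is taken; such a time is a
   successor. *)
have [n /= Nn] := pj N.+1 Logic.I.
case: n Nn => [//|n] Nn Kn.
exact: (NP n Nn).
Qed.
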